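(* In the setting described in the context, with probability one $x_n \to \nu$ as $n\to\infty$. If furthermore $l(\gamma)<0$, then $$\limsup_{n\to+\infty} \frac{1}{\tau_n}\ln\left(\|x_n-\nu\|\right) \le \max\left(-R,\ \frac{l(\gamma)}{2}\right)\quad \text{almost surely.}$$
   Context: Let $F$ be a finite set containing an element $0$, and $F^*=F\setminus\{0\}$ with cardinality $d\ge 2$. Let $P=(P_{i,j})_{i,j\in F}$ be a stochastic matrix such that $0$ is absorbing ($P_{0,i}=0$ for all $i\in F^*$), $P_{i,0}>0$ for some $i\in F^*$, and $F^*$ is an irreducible class: $\sum_{k\ge 0}(P^k)_{i,j}>0$ for all $i,j\in F^*$. No aperiodicity is assumed. Let $\hat P=(P_{i,j})_{i,j\in F^*}$. Let $\Delta$ be the set of probability measures on $F^*$, identified with the unit simplex of $\mathbb{R}^d$. Put $\|x\|=\sum_{i\in F^*}|x(i)|$. The quasi-stationary distribution $\nu$ is the unique element of $\Delta$ such that $\nu\hat P=\lambda\nu$ for some $\lambda\in(0,1)$; one has $\lambda = 1-\sum_{i\in F^*}\nu(i)P_{i,0}$. The eigenvalues of $\hat P$, with multiplicity, are $\lambda_1=\lambda,\lambda_2,\dots,\lambda_d$, with $1>\lambda_1\ge|\lambda_2|\ge\dots\ge|\lambda_d|\ge 0$ and $\lambda_i\ne\lambda$ for $i\ge2$. Set $$R=1-(1-\lambda)\max_{i\ge2}\mathrm{Re}\left(\frac1{1-\lambda_i}\right),$$ which is positive. For $x\in\Delta$ let $K[x]$ be the Markov kernel on $F^*$ given by $K[x]_{i,j}=P_{i,j}+P_{i,0}\,x(j)$.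 Let $(\gamma_n)_{n\ge0}$ be a decreasing sequence in $(0,1)$ with $\sum_{n}\gamma_n=+\infty$ and $\lim_{n\to\infty}\gamma_n\ln n=0$. Let $\tau_0=0$, $\tau_n=\sum_{k=1}^n\gamma_k$, and $l(\gamma)=\limsup_{n\to\infty}\frac{\ln\gamma_n}{\tau_n}\in[-\infty,0]$. Let $(X_n)_{n\ge0}$ be an $F^*$-valued process and $(x_n)_{n\ge0}$ a $\Delta$-valued process such that, with $\mathcal F_n=\sigma(X_k: k\le n)$: $x_0$ is $\mathcal F_0$-measurable (e.g. $x_0=\delta_{X_0}$), and for all $n\ge0$, $$\mathbb P(X_{n+1}=j\mid\mathcal F_n)=K[x_n]_{i,j}\ \text{ on } \{X_n=i\},\quad i,j\in F^*,\qquad x_{n+1}=(1-\gamma_n)x_n+\gamma_n\delta_{X_{n+1}}.$$ Convention: $\ln 0=-\infty$. *)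

(* Defs.v *)
From HB Require Import structures.
From mathcomp Require Import all_boot all_order all_algebra.
From mathcomp Require Import all_classical all_reals all_analysis.
From mathcomp Require Import complex.

Set Implicit Arguments.
Unset Strict Implicit.
Unset Printing Implicit Defensive.

Import Order.TTheory GRing.Theory Num.Theory.
Import numFieldNormedType.Exports.

Local Open Scope classical_set_scope.
Local Open Scope ring_scope.

Definition Fstar (F : finType) (o : F) : finType := {i : F | i != o}.

(* Kernels are functions [T -> T -> R]; they are transported to matrices
   indexed by ordinals along [enum_val] to use matrix powers and [char_poly]. *)
Definition mx_of (R : realType) (T : finType) (A : T -> T -> R) : 'M[R]_#|T| :=
  \matrix_(i, j) A (enum_val i) (enum_val j).

Definition kpow (R : realType) (T : finType) (A : T -> T -> R) (k : nat)
    (i j : T) : R :=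
  (mx_of A ^+ k) (enum_rank i) (enum_rank j).

Definition stochastic (R : realType) (T : finType) (A : T -> T -> R) : Prop :=
  (forall i j, 0 <= A i j) /\ (forall i, \sum_j A i j = 1).

Definition absorbing (R : realType) (F : finType) (o : F) (P : F -> F -> R) :=
  forall i : Fstar o, P o (val i) = 0.

Definition irreducible_class (R : realType) (F : finType) (o : F)
    (P : F -> F -> R) : Prop :=
  forall i j : Fstar o,
    (0 < \sum_(0 <= k <oo) (kpow P k (val i) (val j))%:E)%E.

Definition hatP (R : realType) (F : finType) (o : F) (P : F -> F -> R) :
    Fstar o -> Fstar o -> R :=
  fun i j => P (val i) (val j).

Definition simplex (R : realType) (T : finType) (v : T -> R) : Prop :=
  (forall i, 0 <= v i) /\ \sum_i v i = 1.

Definition norm1 (R : realType) (T : finType) (v : T -> R) : R :=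
  \sum_i `|v i|.

Definition dirac_mass (R : realType) (T : finType) (k : T) : T -> R :=
  fun j => (j == k)%:R.

Definition is_qsd (R : realType) (F : finType) (o : F) (P : F -> F -> R)
    (nu : Fstar o -> R) (lambda : R) : Prop :=
  [/\ simplex nu, 0 < lambda < 1 &
      forall j, \sum_i nu i * hatP P i j = lambda * nu j].

(* [s] lists the complex eigenvalues of [A], repeated according to their
   algebraic multiplicities, by nonincreasing modulus. *)
Definition is_spectrum (R : realType) (T : finType) (A : T -> T -> R)
    (s : seq R[i]) : Prop :=
  char_poly (map_mx (real_complex R) (mx_of A)) = \prod_(z <- s) ('X - z%:P)
  /\ sorted (fun z w : R[i] => `|w| <= `|z|) s.

(* Maximum of [g] over a nonempty list; the initial value [g (head x0 s)] is
   itself one of the values, so it does not affect the maximum. *)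
Definition max_over (R : realType) (S : Type) (x0 : S) (s : seq S)
    (g : S -> R) : R :=
  \big[Num.max/g (head x0 s)]_(z <- s) g z.

(* [1 - (1 - lambda) max_(i >= 2) Re (1 / (1 - lambda_i))], where [s] lists
   the eigenvalues [lambda_i], [i >= 2]. *)
Definition rate (R : realType) (lambda : R) (s : seq R[i]) : R :=
  1 - (1 - lambda) *
      max_over 0 s (fun z : R[i] => complex.Re (1 / (1 - z))).

Definition Kernel (R : realType) (F : finType) (o : F) (P : F -> F -> R)
    (x : Fstar o -> R) : Fstar o -> Fstar o -> R :=
  fun i j => P (val i) (val j) + P (val i) o * x j.

Definition tau (R : realType) (gamma : nat -> R) (n : nat) : R :=
  \sum_(1 <= k < n.+1) gamma k.

Definition ell (R : realType) (gamma : nat -> R) : \bar R :=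
  limn_esup (fun n => (ln (gamma n) / tau gamma n)%:E).

Definition step_sequence (R : realType) (gamma : nat -> R) : Prop :=
  [/\ forall n, 0 < gamma n < 1,
      nonincreasing_seq gamma,
      (\sum_(0 <= n <oo) (gamma n)%:E = +oo)%E &
      (fun n => gamma n * ln n%:R) @ \oo --> (0 : R)].

(* sigma(X_k : k <= n) for variables with values in a finite set. *)
Definition history (Omega : Type) (T : finType) (X : nat -> Omega -> T)
    (n : nat) : set (set Omega) :=
  <<s [set A | exists k j, (k <= n)%N /\ A = X k @^-1` [set j]] >>.

Definition measurable_wrt (R : realType) (Omega : Type)
    (G : set (set Omega)) (Y : Omega -> R) : Prop :=
  forall B : set R, measurable B -> G (Y @^-1` B).

(* [Y] is a version of the conditional probability of [A] given [G]. *)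
Definition is_cond_prob (R : realType) (d : measure_display)
    (Omega : measurableType d) (Pr : probability Omega R)
    (G : set (set Omega)) (A : set Omega) (Y : Omega -> R) : Prop :=
  [/\ measurable_wrt G Y,
      Pr.-integrable setT (EFin \o Y) &
      forall B, G B -> (\int[Pr]_(w in B) (Y w)%:E = Pr (A `&` B))%E].

Definition reinforced_process (R : realType) (F : finType) (o : F)
    (P : F -> F -> R) (gamma : nat -> R) (d : measure_display)
    (Omega : measurableType d) (Pr : probability Omega R)
    (X : nat -> Omega -> Fstar o) (x : nat -> Omega -> Fstar o -> R) : Prop :=
  [/\ forall n j, measurable (X n @^-1` [set j]),
      forall n w, simplex (x n w),
      forall j, measurable_wrt (history X 0) (fun w => x 0%N w j),
      forall n j, is_cond_prob Pr (history X n) (X n.+1 @^-1` [set j])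
                    (fun w => Kernel P (x n w) (X n w) j) &
      forall n w j, x n.+1 w j =
        (1 - gamma n) * x n w j + gamma n * dirac_mass R (X n.+1 w) j].

(* Main.v *)
(* Let [M] be the substochastic matrix on [F^*], [A = (1 - M)^-1],
   [b_n = P(X_n, o)] and [h_n = delta_(X_n) M A].  Since the kernel [K[x]] is
   a rank-one perturbation of [M], the fixed matrix [A] solves the Poisson
   equation up to a term that is linear in [x]:
     delta_(X_(n+1)) = m_(n+1) + b_n x_n A + h_n - h_(n+1),
   with [m] a bounded martingale difference.  Hence [x_n] follows, up to noise,
   the linear recursion [x_(n+1) = x_n (1 - gamma_n + gamma_n b_n A)] with a
   random clock [b_n].  If [u > 0] is the right Perron eigenvector of [M], the
   coordinate [x_n u] stays in a compact subset of [(0, oo)], which forces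
   [gamma_n b_n] to behave like [(1 - lambda) gamma_n] on average; comparing
   the coordinate of an eigenvalue [lambda_i] with a power of [x_n u] yields
   the decay [exp (- tau_n (1 - (1 - lambda) Re (1 / (1 - lambda_i))))].

   The noise is averaged with weights [gamma_n]: an exponential moment bound
   and a Borel-Cantelli argument in the time scale [tau] show that it is
   [o(exp (- rho tau_n))] as soon as [gamma_n] times a logarithmic weight is
   [o(exp (- 2 rho tau_n))].  Both claims are instances of one estimate,
   [x_n - nu = o(exp (- rho tau_n))]: convergence is [rho = 0], and the rate
   follows from all [rho < min (R, - l(gamma) / 2)]. *)

Require Import Defs.
From HB Require Import structures.
From mathcomp Require Import all_boot all_order all_algebra.
From mathcomp Require Import all_classical all_reals all_analysis.
From mathcomp Require Import complex measurable_realfun ring lra.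
Set Implicit Arguments.
Unset Strict Implicit.
Unset Printing Implicit Defensive.
Import Order.TTheory GRing.Theory Num.Theory.
Import numFieldNormedType.Exports.
Local Open Scope classical_set_scope.
Local Open Scope ring_scope.

(** * Negligible sequences and a Gronwall lemma *)

(** [eta n = o(exp (- rho * tau n))]; at [rho = 0] this is plain convergence to zero. *)
Definition is_negl (R : realType) (gamma : nat -> R) (rho : R) (eta : nat -> R) :=
  (fun n => eta n * expR (rho * tau gamma n)) @ \oo --> (0 : R).

Lemma cvg0Ml (R : realType) (K : R) (f : nat -> R) :
  f @ \oo --> 0 -> (fun n => K * f n) @ \oo --> (0 : R).
Proof.
by move=> f0; have := cvgMl_tmp (a := K) f0; rewrite mulr0 => h; exact: h.
Qed.

Lemma cvg0_norm (R : realType) (f : nat -> R) :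
  f @ \oo --> 0 -> (fun n => `|f n|) @ \oo --> (0 : R).
Proof. by move=> f0; have := cvg_norm f0; rewrite normr0 => h; exact: h. Qed.

(** [exp (- c t) <= 1 / (1 + c t)], and the right side is convex in [t], hence below its chord on
    [[0, 1]]. *)
Lemma expRN_le_affine (R : realType) (c t : R) : 0 < c -> 0 <= t <= 1 ->
  expR (- (c * t)) <= 1 - c / (1 + c) * t.
Proof.
move=> c0 /andP[t0 t1].
have ct0 : 0 <= c * t by rewrite mulr_ge0 // ltW.
have c1 : 0 < 1 + c by lra.
have ct1 : 0 < 1 + c * t by lra.
rewrite expRN; apply: (@le_trans _ _ (1 + c * t)^-1).
  by rewrite lef_pV2 ?posrE ?expR_gt0 // expR_ge1Dx.
rewrite -subr_ge0.
have -> : 1 - c / (1 + c) * t - (1 + c * t)^-1 =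
    (c * t) * (c * (1 - t)) / ((1 + c) * (1 + c * t)).
  by field; rewrite !gt_eqF.
rewrite divr_ge0 // mulr_ge0 // ?(ltW c1) ?(ltW ct1) //.
by rewrite mulr_ge0 ?subr_ge0 // ltW.
Qed.

Section negligible.
Variables (R : realType) (gamma : nat -> R).
Hypothesis g01 : forall n, 0 < gamma n < 1.
Hypothesis gdec : nonincreasing_seq gamma.
Local Notation tau := (tau gamma).
Local Notation negl := (is_negl gamma).

Let g0 n : 0 < gamma n. Proof. by have /andP[] := g01 n. Qed.

Let g1 n : gamma n < 1. Proof. by have /andP[] := g01 n. Qed.

Lemma tauS n : tau n.+1 = tau n + gamma n.+1.
Proof. by rewrite /Defs.tau big_nat_recr. Qed.

Lemma tau_ge0 n : 0 <= tau n.
Proof. by apply: sumr_ge0 => i _; apply: ltW. Qed.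

Lemma le_tau : {homo tau : m n / (m <= n)%N >-> m <= n}.
Proof.
move=> m n /subnK <-; elim: (n - m)%N => [|k IH]; first by [].
by rewrite addSn tauS (le_trans IH) // lerDl ltW.
Qed.

(** The sum [tau] starts at index 1, so its increment is [gamma n.+1], whereas the recursions step
    by [gamma n]; monotonicity of [gamma] bridges the shift. *)
Lemma tau_step n : tau n.+1 <= tau n + gamma n.
Proof. by rewrite tauS lerD2l gdec. Qed.

Lemma tau_le_nat n : tau n <= n%:R.
Proof.
elim: n => [|n IH]; first by rewrite /Defs.tau big_geq.
by rewrite tauS -natr1 lerD // ltW.
Qed.

Lemma negl_le rho K (eta r : nat -> R) :
  (\forall n \near \oo, `|r n| <= K * `|eta n|) ->
  negl rho eta -> negl rho r.
Proof.
move=> le_r eta0; apply: norm_cvg0.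
apply: (@squeeze_cvgr _ _ _ _ (fun=> 0)
          (fun n => K * `|eta n * expR (rho * tau n)|)).
- near=> n; rewrite normr_ge0 /= !normrM mulrA ler_wpM2r //.
  by near: n.
- exact: cvg_cst.
- exact/cvg0Ml/cvg0_norm.
Unshelve. all: by end_near. Qed.

Lemma negl_norm rho (eta : nat -> R) :
  negl rho (fun n => `|eta n|) -> negl rho eta.
Proof.
by apply: (negl_le (K := 1)); near=> n; rewrite normr_id mul1r.
Unshelve. all: by end_near. Qed.

Lemma norm_negl rho (eta : nat -> R) :
  negl rho eta -> negl rho (fun n => `|eta n|).
Proof.
by apply: (negl_le (K := 1)); near=> n; rewrite normr_id mul1r.
Unshelve. all: by end_near. Qed.

Lemma neglD rho (e1 e2 : nat -> R) :
  negl rho e1 -> negl rho e2 -> negl rho (fun n => e1 n + e2 n).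
Proof.
move=> h1 h2; rewrite /is_negl; under eq_fun do rewrite mulrDl.
by have := cvgD h1 h2; rewrite addr0 => h; exact: h.
Qed.

Lemma negl0 rho : negl rho (fun=> 0).
Proof.
by rewrite /is_negl; under eq_fun do rewrite mul0r; exact: cvg_cst.
Qed.

Lemma negl_sum rho (I : Type) (s : seq I) (e : I -> nat -> R) :
  (forall i, negl rho (e i)) -> negl rho (fun n => \sum_(i <- s) e i n).
Proof.
move=> he; elim: s => [|i s IH].
  by under eq_fun do rewrite big_nil; exact: negl0.
by under eq_fun do rewrite big_cons; exact: neglD.
Qed.

Lemma neglM rho K (c e : nat -> R) :
  (forall n, `|c n| <= K) -> negl rho e -> negl rho (fun n => c n * e n).
Proof.
move=> hc; apply: (negl_le (K := K)); near=> n.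
by rewrite normrM ler_wpM2r.
Unshelve. all: by end_near. Qed.

Lemma negl_leq_rate rho rho' (e : nat -> R) :
  rho' <= rho -> negl rho e -> negl rho' e.
Proof.
move=> hr he; apply: norm_cvg0.
apply: (@squeeze_cvgr _ _ _ _ (fun=> 0)
          (fun n => `|e n * expR (rho * tau n)|)).
- near=> n; rewrite normr_ge0 /= !normrM ler_wpM2l //.
  by rewrite !ger0_norm ?expR_ge0 // ler_expR ler_wpM2r // tau_ge0.
- exact: cvg_cst.
- exact: cvg0_norm.
Unshelve. all: by end_near. Qed.

Lemma negl_cvg0 rho (e : nat -> R) : 0 <= rho -> negl rho e -> e @ \oo --> 0.
Proof.
move=> r0 /(negl_leq_rate r0); rewrite /is_negl.
by under eq_fun do rewrite mul0r expR0 mulr1.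
Qed.

Lemma cvg0_negl (e : nat -> R) : e @ \oo --> 0 -> negl 0 e.
Proof.
by rewrite /is_negl; under eq_fun do rewrite mul0r expR0 mulr1.
Qed.

Hypothesis tauoo : tau @ \oo --> +oo.


Lemma expR_tau_cvg0 c : 0 < c -> (fun n => expR (- (c * tau n))) @ \oo --> 0.
Proof.
move=> c0.
have h : c * x @[x --> +oo] --> +oo by exact: (gt0_cvgMry c0 cvg_id).
have := cvg_comp _ _ tauoo (cvg_comp _ _ h (@cvgr_expR R)).
by rewrite /comp.
Qed.

(** Iterating from a rank [N] multiplies exponentials; by [tau_step] their product is at most
    [exp (- c * (tau n - tau N))]. *)
Lemma gronwall0 c (r : nat -> R) : 0 < c ->
  (\forall n \near \oo, 0 <= r n) ->
  (\forall n \near \oo, r n.+1 <= expR (- (c * gamma n)) * r n) ->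
  r @ \oo --> 0.
Proof.
move=> c0 [N1 _ r0] [N2 _ rS]; pose N := maxn N1 N2.
have rN n : (N <= n)%N -> r n <= r N * expR (c * tau N) * expR (- (c * tau n)).
  move=> /subnK <-; elim: (n - N)%N => [|k IH].
    by rewrite add0n -mulrA -expRD subrr expR0 mulr1.
  rewrite addSn; apply: (le_trans (rS _ _)).
    by rewrite /= (leq_trans _ (leq_addl _ _)) // leq_maxr.
  apply: (le_trans (ler_wpM2l (expR_ge0 _) IH)).
  rewrite mulrCA ler_wpM2l //.
    by rewrite mulr_ge0 ?expR_ge0 // r0 //= leq_maxl.
  rewrite -expRD ler_expR -opprD lerN2 -mulrDr ler_wpM2l ?(ltW c0) //.
  by rewrite addrC tau_step.
apply: (@squeeze_cvgr _ _ _ _ (fun=> 0)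
   (fun n => r N * expR (c * tau N) * expR (- (c * tau n)))).
- exists N => // n /= Nn; rewrite rN // andbT r0 //=.
  exact: leq_trans (leq_maxl _ _) Nn.
- exact: cvg_cst.
- exact/cvg0Ml/expR_tau_cvg0.
Qed.

(** The excess of [r] over the level [e / 2] obeys a homogeneous recursion as soon as
    [eta n <= c' * (e / 2)]: the contraction lowers the level by at least what the perturbation
    adds. *)
Lemma gronwall1 c (r eta : nat -> R) : 0 < c ->
  (\forall n \near \oo, 0 <= r n) ->
  (\forall n \near \oo, r n.+1 <= expR (- (c * gamma n)) * r n
                                  + gamma n * eta n) ->
  eta @ \oo --> 0 -> r @ \oo --> 0.
Proof.
move=> c0 r0 rS eta0; apply/cvgr0Pnorm_lt => e e0.
(* The slope of the chord bound [exp (- c * gamma n) <= 1 - c' * gamma n]. *)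
pose c' := c / (1 + c).
have c'0 : 0 < c' by rewrite divr_gt0 //; lra.
pose v n := Num.max (r n - e / 2) 0.
have v0 : v @ \oo --> 0.
  apply: (gronwall0 c'0).
    by near=> n; rewrite le_max lexx orbT.
  have etas : \forall n \near \oo, `|eta n| < c' * (e / 2).
    by move: eta0 => /cvgr0Pnorm_lt; apply; rewrite mulr_gt0 // divr_gt0.
  near=> n; rewrite {1}/v ge_max; apply/andP; split; last first.
    by rewrite mulr_ge0 ?expR_ge0 // le_max lexx orbT.
  have h1 : r n.+1 <= expR (- (c * gamma n)) * r n + gamma n * eta n.
    by near: n.
  have h2 : eta n <= c' * (e / 2).
    by apply: ltW; apply: le_lt_trans (ler_norm _) _; near: n.
  have h3 : expR (- (c * gamma n)) <= 1 - c' * gamma n.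
    by apply: expRN_le_affine => //; rewrite !ltW // ?g0 ?g1.
  have h4 : 1 - c' * gamma n <= expR (- (c' * gamma n)) by exact: expR_ge1Dx.
  have h5 : 0 <= r n by near: n.
  have h6 : r n - e / 2 <= v n by rewrite le_max lexx.
  have h7 : 0 <= v n by rewrite le_max lexx orbT.
  have h8 : expR (- (c * gamma n)) * r n <= (1 - c' * gamma n) * r n.
    by rewrite ler_wpM2r.
  have h9 : gamma n * eta n <= gamma n * (c' * (e / 2)).
    by rewrite ler_wpM2l // ltW.
  have c'1 : c' <= 1 by rewrite /c' ler_pdivrMr ?mul1r; lra.
  have h10 : (1 - c' * gamma n) * (r n - e / 2) <= (1 - c' * gamma n) * v n.
    rewrite ler_wpM2l // subr_ge0.
    by rewrite mulr_ile1 ?(ltW c'0) ?(ltW (g0 n)) ?(ltW (g1 n)).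
  have h11 : (1 - c' * gamma n) * v n <= expR (- (c' * gamma n)) * v n.
    by rewrite ler_wpM2r.
  lra.
have vs : \forall n \near \oo, `|v n| < e / 2.
  by move: v0 => /cvgr0Pnorm_lt; apply; rewrite divr_gt0.
near=> n.
have h1 : `|v n| < e / 2 by near: n.
have h2 : 0 <= r n by near: n.
rewrite ger0_norm //.
have h3 : r n - e / 2 <= `|v n|.
  by apply: le_trans (ler_norm _); rewrite le_max lexx.
lra.
Unshelve. all: by end_near. Qed.

(** Rescaling by [exp (rho * tau n)] costs at most a factor [exp (rho * gamma n)] per step, which
    leaves the contraction rate [c - rho > 0]. *)
Lemma gronwall rho c (r eta : nat -> R) : 0 <= rho < c ->
  (\forall n \near \oo, 0 <= r n) ->
  (\forall n \near \oo, r n.+1 <= expR (- (c * gamma n)) * r n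
                                  + gamma n * eta n) ->
  negl rho eta -> negl rho r.
Proof.
move=> /andP[rho0 rhoc] r0 rS /norm_negl eta0.
apply: (@gronwall1 (c - rho) _
         (fun n => expR rho * (`|eta n| * expR (rho * tau n)))).
- by rewrite subr_gt0.
- near=> n; rewrite mulr_ge0 ?expR_ge0 //; near: n; exact: r0.
- near=> n.
  have h1 : r n.+1 <= expR (- (c * gamma n)) * r n + gamma n * eta n.
    by near: n.
  have h2 : 0 <= r n by near: n.
  have h3 : expR (rho * tau n.+1) <= expR (rho * gamma n) * expR (rho * tau n).
    by rewrite -expRD ler_expR -mulrDr ler_wpM2l // addrC tau_step.
  have h4 : expR (rho * gamma n) <= expR rho.
    by rewrite ler_expR ler_piMr // ltW // g1.
  have h5 : r n.+1 <= expR (- (c * gamma n)) * r n + gamma n * `|eta n|.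
    by apply: le_trans h1 _; rewrite lerD2l ler_wpM2l ?ler_norm // ltW.
  apply: (le_trans (ler_wpM2r (expR_ge0 _) h5)).
  rewrite mulrDl; apply: lerD.
    have -> : expR (- ((c - rho) * gamma n)) * (r n * expR (rho * tau n)) =
              expR (- (c * gamma n)) * r n *
                (expR (rho * gamma n) * expR (rho * tau n)).
      rewrite mulrBl opprB [_ - c * _]addrC expRD; ring.
    by rewrite ler_wpM2l // mulr_ge0 // expR_ge0.
  rewrite -mulrA ler_wpM2l ?(ltW (g0 n)) // mulrCA ler_wpM2l //.
  by apply: le_trans h3 _; rewrite ler_wpM2r // expR_ge0.
- exact: cvg0Ml.
Unshelve. all: by end_near. Qed.

End negligible.

(** * Scalar recursions with a random clock *)

(** The bound [ln (1 + t) >= t - 2 t^2] in exponential form: invert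
    [exp (- t + 2 t^2) >= 1 - t + 2 t^2] and check that [1 + t] times the latter is at least 1. *)
Lemma expR_le_1Dx (R : realType) (t : R) : - (1 / 2) <= t ->
  expR (t - 2 * t ^+ 2) <= 1 + t.
Proof.
move=> t2; have t2' : 0 <= t ^+ 2 by rewrite sqr_ge0.
have p : 0 < 1 - t + 2 * t ^+ 2.
  have -> : 1 - t + 2 * t ^+ 2 = 2 * (t - 1 / 4) ^+ 2 + 7 / 8 by field.
  by have := sqr_ge0 (t - 1 / 4); lra.
have -> : t - 2 * t ^+ 2 = - (- t + 2 * t ^+ 2) by ring.
rewrite expRN; apply: (@le_trans _ _ (1 - t + 2 * t ^+ 2)^-1).
  rewrite lef_pV2 ?posrE ?expR_gt0 //.
  by apply: le_trans (expR_ge1Dx _); rewrite addrA.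
rewrite -div1r ler_pdivrMr //.
have -> : (1 + t) * (1 - t + 2 * t ^+ 2) = 1 + t ^+ 2 * (1 + 2 * t) by ring.
by rewrite lerDl mulr_ge0 //; lra.
Qed.

(** Meant for exponential moments: the linear term of a centered variable vanishes in the mean and
    only the subgaussian factor remains. For [x > 1 / 2] already [x <= 2 x^2]. *)
Lemma expR_le_addx (R : realType) (x : R) : expR x <= x + expR (2 * x ^+ 2).
Proof.
have x2 : 0 <= x ^+ 2 by rewrite sqr_ge0.
have [hx|hx] := leP x (1 / 2); last first.
  apply: (@le_trans _ _ (expR (2 * x ^+ 2))); last by rewrite lerDr; lra.
  by rewrite ler_expR expr2; nra.
apply: (@le_trans _ _ (x + (1 + 2 * x ^+ 2))); last by rewrite lerD2l expR_ge1Dx.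
have x1 : 0 < 1 - x by lra.
apply: (@le_trans _ _ (1 - x)^-1).
  rewrite -[X in expR X]opprK expRN lef_pV2 ?posrE ?expR_gt0 //.
  exact: expR_ge1Dx.
rewrite -div1r ler_pdivrMr //.
have -> : (x + (1 + 2 * x ^+ 2)) * (1 - x) = 1 + x ^+ 2 * (1 - 2 * x) by ring.
by rewrite lerDl mulr_ge0 //; lra.
Qed.

Local Notation normc := ComplexField.Normc.normc.

Lemma normc_ge0 (R : rcfType) (z : R[i]) : 0 <= normc z.
Proof. by case: z => x y; exact: sqrtr_ge0. Qed.

Lemma normc_sqr (R : rcfType) (z : R[i]) :
  normc z ^+ 2 = complex.Re z ^+ 2 + complex.Im z ^+ 2.
Proof. by case: z => x y /=; rewrite sqr_sqrtr // addr_ge0 ?sqr_ge0. Qed.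

Lemma normc_real (R : rcfType) (x : R) : normc x%:C%C = `|x|.
Proof. by rewrite /= expr0n addr0 sqrtr_sqr. Qed.

(** From [|1 + s|^2 = 1 + 2 Re s + |s|^2 <= exp (2 Re s + |s|^2)]. *)
Lemma normc_le_expR (R : realType) (s : R[i]) :
  normc (1 + s) <= expR (complex.Re s + normc s ^+ 2 / 2).
Proof.
rewrite -(@ler_pXn2r _ 2) ?nnegrE ?normc_ge0 ?expR_ge0 //.
have -> : normc (1 + s) ^+ 2 = 1 + (2 * complex.Re s + normc s ^+ 2).
  by rewrite !normc_sqr; case: s => x y /=; ring.
apply: (le_trans (expR_ge1Dx _)).
by rewrite -expRM_natl ler_expR -mulr_natl; lra.
Qed.

Section scalar_decay.
Variables (R : realType) (gamma : nat -> R).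
Hypothesis g01 : forall n, 0 < gamma n < 1.
Hypothesis gdec : nonincreasing_seq gamma.
Local Notation negl := (is_negl gamma).
Hypothesis tauoo : tau gamma @ \oo --> +oo.
Hypothesis gto0 : gamma @ \oo --> 0.

Let g0 n : 0 < gamma n. Proof. by have /andP[] := g01 n. Qed.

Lemma near_gammaM_le (K e : R) : 0 < e -> \forall n \near \oo, gamma n * K <= e.
Proof.
move=> e0.
have h : (fun n => K * gamma n) @ \oo --> 0 by exact: cvg0Ml.
move/cvgr0Pnorm_lt: h => /(_ _ e0); apply: filterS => n h.
by rewrite mulrC (le_trans (ler_norm _)) // ltW.
Qed.

Variables (alpha lo hi : R) (a b eta : nat -> R).
Hypothesis alpha0 : 0 < alpha.
Hypothesis b01 : forall n, 0 <= b n <= 1.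
Hypothesis lo0 : 0 < lo.
Hypothesis alohi : \forall n \near \oo, lo <= a n <= hi.
Hypothesis aS : forall n,
  a n.+1 = a n * (1 - gamma n + gamma n * b n * alpha) + gamma n * eta n.
Hypothesis eta0 : eta @ \oo --> 0.

(** The recursion reads [a n.+1 = a n * (1 + t)]. The quadratic loss in [ln (1 + t)] and the
    quotient [eta n / a n], controlled by [lo <= a n], each cost at most [gamma n * e / 2] in the
    end. *)
Lemma near_ln_growth e : 0 < e -> \forall n \near \oo,
  ln (a n) + gamma n * (- 1 + b n * alpha - e) <= ln (a n.+1).
Proof.
move=> e0; pose B := 2 + alpha.
have B0 : 0 < B by rewrite /B addr_gt0.
have le1 : 0 < lo * e / 2 by rewrite divr_gt0 ?mulr_gt0.
have a1 : \forall n \near \oo, lo <= a n.+1 <= hi.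
  by move: alohi => [N _ h]; exists N => // n Nn; apply: h; exact: leqW.
near=> n.
have ha : lo <= a n <= hi by near: n.
have ha1 : lo <= a n.+1 <= hi by near: n.
have h1 : `|eta n| < lo * e / 2.
  by near: n; move: eta0 => /cvgr0Pnorm_lt; apply.
have h2 : `|eta n| < lo.
  by near: n; move: eta0 => /cvgr0Pnorm_lt; apply.
have h3 : gamma n * B <= 1 / 2 by near: n; apply: near_gammaM_le; rewrite divr_gt0.
have h4 : gamma n * (2 * B ^+ 2) <= e / 2.
  by near: n; apply: near_gammaM_le; rewrite divr_gt0.
have /andP[loa _] := ha.
have an0 : 0 < a n by exact: lt_le_trans loa.
have an10 : 0 < a n.+1 by apply: lt_le_trans lo0 _; case/andP: ha1.
pose q := eta n / a n.
have q1 : `|q| <= e / 2.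
  rewrite /q normrM normfV (gtr0_norm an0) ler_pdivrMr //.
  apply: (le_trans (ltW h1)); rewrite -mulrA mulrC.
  by rewrite ler_wpM2l // ltW // divr_gt0.
have q2 : `|q| <= 1.
  rewrite /q normrM normfV (gtr0_norm an0) ler_pdivrMr // mul1r.
  exact: le_trans (ltW h2) loa.
pose t := gamma n * (- 1 + b n * alpha + q).
have /andP[b0 b1] := b01 n.
have ba : 0 <= b n * alpha <= alpha.
  by rewrite mulr_ge0 ?(ltW alpha0) //= ler_piMl // ltW.
have tB : `|t| <= gamma n * B.
  rewrite /t normrM (gtr0_norm (g0 n)) ler_wpM2l // ?(ltW (g0 n)) // /B.
  by move: q2; rewrite !ler_norml => /andP[? ?]; apply/andP; split; lra.
have aE : a n.+1 = a n * (1 + t).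
  by rewrite aS /t /q; field; rewrite gt_eqF.
have t12 : - (1 / 2) <= t.
  by move: tB; rewrite ler_norml => /andP[? _]; lra.
have h5 := expR_le_1Dx t12.
have t1 : 0 < 1 + t by exact: lt_le_trans (expR_gt0 _) h5.
rewrite aE lnM ?posrE // lerD2l.
apply: (@le_trans _ _ (t - 2 * t ^+ 2)); last first.
  by rewrite -[X in X <= _](@expRK R) ler_ln ?posrE // expR_gt0.
have h6 : t ^+ 2 <= (gamma n * B) ^+ 2.
  by rewrite -(real_normK (num_real t)) ler_pXn2r ?nnegrE // mulr_ge0 // ltW.
have h7 : 2 * (gamma n * B) ^+ 2 <= gamma n * (e / 2).
  have -> : 2 * (gamma n * B) ^+ 2 = gamma n * (gamma n * (2 * B ^+ 2)) by ring.
  by rewrite ler_wpM2l // ltW.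
have h8 : - (e / 2) <= q by move: q1; rewrite ler_norml => /andP[].
have h9 : gamma n * (- 1 + b n * alpha - e / 2) <= t.
  by rewrite /t ler_wpM2l ?(ltW (g0 n)) // lerD2l.
have -> : gamma n * (- 1 + b n * alpha - e) =
  gamma n * (- 1 + b n * alpha - e / 2) - gamma n * (e / 2) by field.
lra.
Unshelve. all: by end_near. Qed.

(** The factor is [1 + s] with [|s|] of order [gamma n], so the term [|s|^2 / 2] of [normc_le_expR]
    is absorbed by [gamma n * e]. *)
Lemma near_normc_factor (mu : R[i]) e : 0 < e -> \forall n \near \oo,
  normc ((1 - gamma n)%:C%C + (gamma n * b n)%:C%C * mu) <=
  expR (gamma n * (- 1 + b n * complex.Re mu + e)).
Proof.
move=> e0; near=> n.
have h1 : gamma n * (1 + normc mu) ^+ 2 <= e.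
  by near: n; apply: near_gammaM_le.
pose s : R[i] := (gamma n)%:C%C * (-1 + (b n)%:C%C * mu).
have -> : (1 - gamma n)%:C%C + (gamma n * b n)%:C%C * mu = 1 + s.
  by rewrite /s rmorphB rmorphM rmorph1; ring.
apply: (le_trans (normc_le_expR _)); rewrite ler_expR.
have -> : complex.Re s = gamma n * (- 1 + b n * complex.Re mu).
  by rewrite /s; case: (mu) => x y /=; ring.
rewrite [leRHS]mulrDr lerD2l.
have /andP[b0 b1] := b01 n.
have hs : normc s <= gamma n * (1 + normc mu).
  rewrite /s ComplexField.Normc.normcM normc_real (gtr0_norm (g0 n)).
  rewrite ler_wpM2l ?(ltW (g0 n)) //.
  apply: (le_trans (le_normcD _ _)); apply: lerD.
    by rewrite normcN ComplexField.Normc.normc1.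
  rewrite ComplexField.Normc.normcM normc_real ger0_norm // ler_piMl //.
  exact: normc_ge0.
have hs2 : normc s ^+ 2 <= (gamma n * (1 + normc mu)) ^+ 2.
  rewrite ler_pXn2r ?nnegrE ?normc_ge0 //.
  by rewrite mulr_ge0 ?(ltW (g0 n)) // addr_ge0 // normc_ge0.
have h2 : (gamma n * (1 + normc mu)) ^+ 2 <= gamma n * e.
  rewrite exprMn expr2 -mulrA ler_wpM2l //; exact: ltW.
have h3 : 0 <= gamma n * e by rewrite mulr_ge0 // ltW.
lra.
Unshelve. all: by end_near. Qed.

(* [r n = |zeta n| / a n ^ k] with [k = Re mu / alpha]: in the ratio the random
   factors [exp (gamma n * b n * Re mu)] cancel. *)
Lemma scalar_decay rho (mu : R[i]) (zeta xi : nat -> R[i]) :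
  0 <= rho -> 0 <= complex.Re mu -> rho < 1 - complex.Re mu / alpha ->
  (forall n, zeta n.+1 =
     ((1 - gamma n)%:C%C + (gamma n * b n)%:C%C * mu) * zeta n +
     (gamma n)%:C%C * xi n) ->
  negl rho (fun n => normc (xi n)) -> negl rho (fun n => normc (zeta n)).
Proof.
move=> rho0 mu0 rhok zS xi0; pose k := complex.Re mu / alpha.
have k0 : 0 <= k by rewrite divr_ge0 // ltW.
have k1 : 0 < 1 + k by lra.
(* The error [e] is paid once by the complex factor and [k] times by the power of [a]; this value
   makes the resulting rate [c = 1 - k - e * (1 + k)] the midpoint of [rho] and [1 - k]. *)
pose e := (1 - k - rho) / 2 / (1 + k).
have e0 : 0 < e by rewrite !divr_gt0 // subr_gt0.
pose c := (1 - k + rho) / 2.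
have cE : c = 1 - k - e * (1 + k) by rewrite /c /e; field; rewrite gt_eqF.
pose r n := normc (zeta n) * expR (- (k * ln (a n))).
have a1 : \forall n \near \oo, lo <= a n.+1 <= hi.
  by move: alohi => [N _ h]; exists N => // n Nn; apply: h; exact: leqW.
have r_negl : negl rho r.
  apply: (@gronwall _ _ g01 gdec tauoo rho c _
            (fun n => expR (- (k * ln lo)) * normc (xi n))).
  - by rewrite rho0 /= /c ltr_pdivlMr //; move: rhok; rewrite -/k; lra.
  - by near=> n; rewrite mulr_ge0 ?normc_ge0 ?expR_ge0.
  - near=> n.
    have ha1 : lo <= a n.+1 <= hi by near: n.
    have h1 : ln (a n) + gamma n * (- 1 + b n * alpha - e) <= ln (a n.+1).
      by near: n; exact: near_ln_growth.
    have h2 : normc ((1 - gamma n)%:C%C + (gamma n * b n)%:C%C * mu) <=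
        expR (gamma n * (- 1 + b n * complex.Re mu + e)).
      by near: n; exact: near_normc_factor.
    rewrite {1}/r zS.
    apply: (le_trans (ler_wpM2r (expR_ge0 _) (le_normcD _ _))).
    rewrite !ComplexField.Normc.normcM normc_real (gtr0_norm (g0 n)) mulrDl.
    apply: lerD; last first.
      rewrite -mulrA [normc (xi n) * _]mulrC !mulrA ler_wpM2r ?normc_ge0 //.
      rewrite ler_wpM2l ?(ltW (g0 n)) // ler_expR lerN2 ler_wpM2l //.
      have /andP[h3 _] := ha1.
      by rewrite ler_ln ?posrE //; exact: lt_le_trans h3.
    rewrite /r [leRHS]mulrCA [X in X * _ <= _]mulrC -mulrA.
    rewrite ler_wpM2l ?normc_ge0 //.
    apply: (le_trans (ler_wpM2r (expR_ge0 _) h2)).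
    rewrite -!expRD ler_expR cE.
    have := ler_wpM2l k0 h1.
    have -> : complex.Re mu = k * alpha by rewrite /k divfK // gt_eqF.
    lra.
  - apply: (neglM (K := expR (- (k * ln lo)))) => // n.
    by rewrite ger0_norm ?expR_ge0.
apply: (negl_le (K := expR (k * ln hi))) r_negl.
near=> n.
have /andP[h1 h2] : lo <= a n <= hi by near: n.
rewrite /r normrM !ger0_norm ?normc_ge0 ?expR_ge0 // mulrCA ler_peMr ?normc_ge0 //.
rewrite -expRD -[X in X <= _]expR0 ler_expR -mulrBr mulr_ge0 // subr_ge0.
have la : 0 < a n by exact: lt_le_trans h1.
by rewrite ler_ln ?posrE //; exact: lt_le_trans h2.
Unshelve. all: by end_near. Qed.

End scalar_decay.

(** * Perron-Frobenius theory *)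

Section perron.
Variables (R : realType) (n : nat) (M : 'M[R]_n) (lam : R) (nu : 'rV[R]_n).
Hypothesis M0 : forall i j, 0 <= M i j.
Hypothesis irr : forall S : 'I_n -> Prop, (exists i, S i) ->
  (forall i j, S i -> 0 < M i j -> S j) -> forall j, S j.
Hypothesis lam01 : 0 < lam < 1.
Hypothesis nu0 : forall i, 0 <= nu 0 i.
Hypothesis nu1 : \sum_i nu 0 i = 1.
Hypothesis nuM : nu *m M = lam *: nu.

Let lam0 : 0 < lam. Proof. by case/andP: lam01. Qed.

(** The support of [v] is nonempty and closed under the positive entries of [M], so irreducibility,
    in its closed-set form, makes it everything. *)
Lemma left_eigenvector_gt0 (v : 'rV[R]_n) : (forall i, 0 <= v 0 i) ->
  v *m M = lam *: v -> forall i, 0 < v 0 i -> forall j, 0 < v 0 j.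
Proof.
move=> v0 vM i vi; apply: irr; first by exists i.
move=> k j vk Mkj; have /rowP/(_ j) := vM; rewrite !mxE => h.
rewrite -(pmulr_rgt0 _ lam0) -h (bigD1 k) //= ltr_pwDl ?mulr_gt0 //.
by apply: sumr_ge0 => l _; exact: mulr_ge0.
Qed.

Lemma nu_gt0 j : 0 < nu 0 j.
Proof.
have [i hi] : exists i, 0 < nu 0 i.
  apply/existsP; apply: contraT; rewrite negb_exists => /forallP h.
  have := nu1; rewrite big1; first by move/eqP; rewrite eq_sym oner_eq0.
  by move=> i _; apply/eqP; rewrite eq_le nu0 andbT leNgt.
exact: (left_eigenvector_gt0 nu0 nuM hi).
Qed.

(** Subtract from [w] the largest multiple of [nu] below it: the difference is a nonnegative
    eigenvector with a zero coordinate, hence zero by [left_eigenvector_gt0]. *)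
Lemma left_eigenvector_unique (w : 'rV[R]_n) :
  w *m M = lam *: w -> exists c, w = c *: nu.
Proof.
move=> wM; have [i0 _] : exists i : 'I_n, True.
  apply: contrapT => h; have := nu1; rewrite big1.
    by move/eqP; rewrite eq_sym oner_eq0.
  by move=> i _; exfalso; apply: h; exists i.
have [k _ hk] := Order.TotalTheory.arg_minP (fun j => w 0 j / nu 0 j)
  (erefl : xpredT i0).
pose c := w 0 k / nu 0 k; exists c.
pose v := w - c *: nu.
have v0 j : 0 <= v 0 j.
  by rewrite !mxE subr_ge0 -ler_pdivlMr ?nu_gt0 //; exact: hk.
have vM : v *m M = lam *: v.
  by rewrite mulmxBl wM -scalemxAl nuM scalerBr !scalerA mulrC.
have vk : v 0 k = 0 by rewrite !mxE divfK ?subrr // gt_eqF // nu_gt0.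
suff : v = 0 by move/eqP; rewrite subr_eq0 => /eqP.
apply/rowP => j; rewrite [RHS]mxE; apply/eqP; rewrite eq_le v0 andbT leNgt.
by apply/negP => /(left_eigenvector_gt0 v0 vM)/(_ k); rewrite vk ltxx.
Qed.

(** Transposing the singular matrix gives a right eigenvector [v], and [lam |v| <= M |v|]. Pairing
    with the positive [nu] forces equality, and irreducibility then makes [|v|] positive. *)
Lemma right_eigenvector_gt0 : exists u : 'cV[R]_n,
  [/\ forall i, 0 < u i 0, M *m u = lam *: u & nu *m u = 1%:M].
Proof.
have dM : \det (M - lam%:M) == 0.
  apply/det0P; exists nu.
    apply/eqP => h; have := nu1; rewrite h big1.
      by move/eqP; rewrite eq_sym oner_eq0.
    by move=> i _; rewrite mxE.
  by rewrite mulmxBr nuM mul_mx_scalar subrr.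
move: dM; rewrite -det_tr => /det0P[v vn0 vM].
have {}vM i : \sum_j M i j * v 0 j = lam * v 0 i.
  move/rowP/(_ i): vM; rewrite linearB /= mulmxBr tr_scalar_mx mul_mx_scalar.
  rewrite !mxE => /eqP; rewrite subr_eq0 => /eqP <-.
  by apply: eq_bigr => j _; rewrite mxE mulrC.
pose a i := `|v 0 i|.
have aM i : lam * a i <= \sum_j M i j * a j.
  rewrite /a -{1}(gtr0_norm lam0) -normrM -vM.
  apply: le_trans (ler_norm_sum _ _ _) _; apply: ler_sum => j _.
  by rewrite normrM ger0_norm.
have aE i : \sum_j M i j * a j = lam * a i.
  have S0 : \sum_i nu 0 i * (\sum_j M i j * a j - lam * a i) = 0.
    under eq_bigr do rewrite mulrBr mulr_sumr.
    rewrite sumrB exchange_big /=; apply/eqP; rewrite subr_eq0; apply/eqP.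
    apply: eq_bigr => j _; have /rowP/(_ j) := nuM; rewrite !mxE => h.
    by rewrite mulrCA mulrA -h mulr_suml; apply: eq_bigr => k _; rewrite mulrA.
  move/eqP: S0; rewrite psumr_eq0; last first.
    by move=> k _; rewrite mulr_ge0 // subr_ge0.
  move/allP/(_ i (mem_index_enum _)); rewrite /= mulf_eq0 gt_eqF ?nu_gt0 //=.
  by rewrite subr_eq0 => /eqP.
have a0 i : 0 <= a i by exact: normr_ge0.
have a_gt0 i : 0 < a i.
  rewrite lt_def a0 andbT; apply/negP => /eqP ai.
  have az : forall j, a j = 0.
    apply: irr; first by exists i.
    move=> k j ak Mkj; have /eqP := aE k; rewrite ak mulr0 psumr_eq0.
      move/allP/(_ j (mem_index_enum _)).
      by rewrite /= mulf_eq0 (gt_eqF Mkj) => /eqP.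
    by move=> l _; exact: mulr_ge0.
  case/negP: vn0; apply/eqP/rowP => j; rewrite [RHS]mxE.
  by apply/eqP; rewrite -normr_eq0; apply/eqP/az.
pose s := \sum_i nu 0 i * a i.
have s0 : 0 < s.
  have [k hk] : exists k, 0 < nu 0 k * a k.
    have [k _] : exists i : 'I_n, True.
      apply: contrapT => h; have := nu1; rewrite big1.
        by move/eqP; rewrite eq_sym oner_eq0.
      by move=> i _; exfalso; apply: h; exists i.
    by exists k; rewrite mulr_gt0 // nu_gt0.
  rewrite /s (bigD1 k) //= ltr_pwDl //.
  by apply: sumr_ge0 => i _; rewrite mulr_ge0.
exists (\col_i (a i / s)); split=> [i||].
- by rewrite mxE divr_gt0.
- apply/colP => i; rewrite !mxE; under eq_bigr do rewrite mxE mulrA.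
  by rewrite -mulr_suml aE mulrA.
- apply/matrixP => i j; rewrite !ord1 !mxE eqxx.
  by under eq_bigr do rewrite mxE mulrA; rewrite -mulr_suml divff // gt_eqF.
Qed.

Variable u : 'cV[R]_n.
Hypothesis u_gt0 : forall i, 0 < u i 0.
Hypothesis Mu : M *m u = lam *: u.
Hypothesis nuu : nu *m u = 1%:M.

(** With weights [u] the matrix is a strict contraction: [v M = v] would give [s <= lam s] for [s]
    the weighted sum of the [|v_i|]. *)
Lemma unitmx_1B : 1%:M - M \in unitmx.
Proof.
rewrite unitmxE unitfE; apply/det0P => -[v vn0 vM].
have {}vM : v *m M = v.
  by move/eqP: vM; rewrite mulmxBr mulmx1 subr_eq0 => /eqP.
pose s := \sum_i `|v 0 i| * u i 0.
have s_le : s <= lam * s.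
  rewrite /s mulr_sumr.
  apply: (@le_trans _ _ (\sum_i \sum_j `|v 0 j| * M j i * u i 0)).
    apply: ler_sum => i _; rewrite -{1}vM mxE -mulr_suml ler_wpM2r //.
      exact: ltW.
    apply: le_trans (ler_norm_sum _ _ _) _; apply: ler_sum => j _.
    by rewrite normrM (ger0_norm (M0 _ _)).
  rewrite exchange_big /= ler_sum // => j _.
  have /colP/(_ j) := Mu; rewrite !mxE => h.
  under eq_bigr do rewrite -mulrA.
  by rewrite -mulr_sumr h mulrCA.
have s0 : 0 <= s by apply: sumr_ge0 => i _; rewrite mulr_ge0 // ltW.
have {s_le}s_eq0 : s == 0.
  rewrite eq_le s0 andbT; have /andP[_ l1] := lam01.
  by rewrite -(pmulr_rle0 s (_ : 0 < 1 - lam)) ?subr_gt0 // mulrBl mul1r subr_le0.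
case/negP: vn0; apply/eqP/rowP => i; rewrite [RHS]mxE.
move: s_eq0; rewrite psumr_eq0; last by move=> k _; rewrite mulr_ge0 // ltW.
move/allP/(_ i (mem_index_enum _)).
by rewrite /= mulf_eq0 normr_eq0 (gt_eqF (u_gt0 i)) orbF => /eqP.
Qed.

(* [M - lam] is invertible on the hyperplane orthogonal to [u]; the rank-one
   term [u nu] only acts in the complementary direction [nu]. *)
Lemma unitmx_deflated : M - lam%:M + u *m nu \in unitmx.
Proof.
rewrite unitmxE unitfE; apply/det0P => -[w wn0 wM].
have wu : w *m u = 0.
  move/(congr1 (mulmx^~ u)): wM.
  rewrite mul0mx mulmxDr mulmxBr mul_mx_scalar mulmxDl mulmxBl.
  by rewrite -!mulmxA Mu -scalemxAl -scalemxAr subrr add0r nuu mulmx1.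
move: wM; rewrite mulmxDr mulmxA wu mul0mx addr0 mulmxBr mul_mx_scalar.
move/eqP; rewrite subr_eq0 => /eqP /left_eigenvector_unique[c wE].
move: wu; rewrite wE -scalemxAl nuu => /matrixP/(_ 0 0); rewrite !mxE eqxx mulr1.
by move=> c0; case/negP: wn0; rewrite wE c0 scale0r.
Qed.

Lemma invmx_comm : invmx (1%:M - M) *m M = M *m invmx (1%:M - M).
Proof.
set A := invmx _.
have : A *m (1%:M - M) = (1%:M - M) *m A.
  by rewrite mulVmx ?mulmxV // unitmx_1B.
by rewrite mulmxBl mulmxBr mulmx1 mul1mx => /addrI/oppr_inj.
Qed.

Let lam1 : 1 - lam != 0.
Proof. by have /andP[_ l1] := lam01; rewrite gt_eqF // subr_gt0. Qed.

Lemma invmx_right_eigenvector : invmx (1%:M - M) *m u = (1 - lam)^-1 *: u.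
Proof.
rewrite -[u in LHS](scalerK lam1) -scalemxAr; congr (_ *: _).
have <- : (1%:M - M) *m u = (1 - lam) *: u.
  by rewrite mulmxBl mul1mx Mu scalerBl scale1r.
by rewrite mulKmx // unitmx_1B.
Qed.

Lemma invmx_left_eigenvector : nu *m invmx (1%:M - M) = (1 - lam)^-1 *: nu.
Proof.
rewrite -[nu in LHS](scalerK lam1) -scalemxAl; congr (_ *: _).
have <- : nu *m (1%:M - M) = (1 - lam) *: nu.
  by rewrite mulmxBr mulmx1 nuM scalerBl scale1r.
by rewrite mulmxK // unitmx_1B.
Qed.

End perron.

(** The product of factors is unrolled into successive multiplications of a row, so that an
    induction on the list can strip one eigenvalue at a time. *)
Lemma Cayley_Hamilton_foldl (C : comNzRingType) n (M : 'M[C]_n) (s : seq C) :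
  char_poly M = \prod_(z <- s) ('X - z%:P) ->
  forall v : 'rV[C]_n, foldl (fun v z => v *m (M - z%:M)) v s = 0.
Proof.
case: n M => [|n] M hs v; first by apply/matrixP => i [].
have h := Cayley_Hamilton M; rewrite hs in h.
have {h} := congr1 (mulmx v) h; rewrite mulmx0 => <-.
elim: s v {hs} => [|z s IH] v; first by rewrite big_nil rmorph1 mulmx1.
rewrite /= IH big_cons rmorphM /= rmorphB /= horner_mx_X horner_mx_C.
by rewrite -mulmxA.
Qed.

(** * Pathwise analysis *)

Section pathwise.
Variables (R : realType) (gamma : nat -> R).
Hypothesis g01 : forall n, 0 < gamma n < 1.
Hypothesis gdec : nonincreasing_seq gamma.
Hypothesis tauoo : tau gamma @ \oo --> +oo.
Hypothesis gto0 : gamma @ \oo --> 0.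
Local Notation negl := (is_negl gamma).

Let g0 n : 0 < gamma n. Proof. by have /andP[] := g01 n. Qed.

Variable rho : R.
Hypothesis rho01 : 0 <= rho < 1.
Hypothesis negl_gamma : negl rho gamma.

(* Adding [gamma k * h k] to [D k] turns the telescoping increments into terms
   of order [gamma k ^+ 2] and [gamma k - gamma k.+1]; the latter are absorbed
   by the potential [C * gamma k]. *)
Lemma telescoping_negl (C : R) (h D : nat -> R) :
  (forall k, `|h k| <= C) ->
  (forall k, D k.+1 = (1 - gamma k) * D k + gamma k * (h k - h k.+1)) ->
  negl rho D.
Proof.
move=> hC DS; pose E k := `|D k + gamma k * h k| + C * gamma k.
have C0 : 0 <= C by exact: le_trans (hC 0%N).
have En : negl rho E.
  apply: (@gronwall _ _ g01 gdec tauoo rho 1 _ (fun k => 2 * C * gamma k)) => //.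
  - by near=> k; rewrite addr_ge0 ?mulr_ge0 // ltW.
  - near=> k; rewrite /E mul1r.
    have -> : D k.+1 + gamma k.+1 * h k.+1 = (1 - gamma k) * (D k + gamma k * h k)
        + (gamma k ^+ 2 * h k - (gamma k - gamma k.+1) * h k.+1).
      by rewrite DS; ring.
    have /andP[_ g1] := g01 k; have gk := g0 k.
    have gS : gamma k.+1 <= gamma k by exact: gdec.
    have n1 := ler_normD ((1 - gamma k) * (D k + gamma k * h k))
      (gamma k ^+ 2 * h k - (gamma k - gamma k.+1) * h k.+1).
    have n2 := ler_normB (gamma k ^+ 2 * h k) ((gamma k - gamma k.+1) * h k.+1).
    have n3 : `|(1 - gamma k) * (D k + gamma k * h k)| =
        (1 - gamma k) * `|D k + gamma k * h k|.
      by rewrite normrM ger0_norm // subr_ge0 ltW.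
    have n4 : `|gamma k ^+ 2 * h k| <= gamma k ^+ 2 * C.
      by rewrite normrM ger0_norm ?sqr_ge0 // ler_wpM2l ?sqr_ge0.
    have n5 : `|(gamma k - gamma k.+1) * h k.+1| <= (gamma k - gamma k.+1) * C.
      by rewrite normrM ger0_norm ?subr_ge0 // ler_wpM2l ?subr_ge0.
    have n6 : (1 - gamma k) * E k <= expR (- gamma k) * E k.
      by rewrite ler_wpM2r ?expR_ge1Dx // addr_ge0 // mulr_ge0 // ltW.
    rewrite /E in n6; rewrite n3 in n1; lra.
  - apply: (negl_le (K := 2 * C)) negl_gamma; near=> k.
    by rewrite normrM ger0_norm // mulr_ge0.
apply: (negl_le (K := 1)) En; near=> k.
rewrite mul1r /E [leRHS]ger0_norm ?addr_ge0 ?mulr_ge0 ?(ltW (g0 _)) //.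
rewrite -[X in `|X| <= _](addrK (gamma k * h k)).
apply: (le_trans (ler_normB _ _)); rewrite lerD2l normrM gtr0_norm // mulrC.
by rewrite ler_wpM2r // ltW.
Unshelve. all: by end_near. Qed.

Local Notation normc := ComplexField.Normc.normc.

Definition negl_row n (v : nat -> 'rV[R[i]]_n) :=
  forall j, negl rho (fun k => normc (v k 0 j)).

Lemma negl_rowD n (v w : nat -> 'rV[R[i]]_n) :
  negl_row v -> negl_row w -> negl_row (fun k => v k + w k).
Proof.
move=> hv hw j; apply: (negl_le (K := 1)) (neglD (hv j) (hw j)); near=> k.
rewrite mul1r !ger0_norm ?addr_ge0 ?normc_ge0 // mxE; exact: le_normcD.
Unshelve. all: by end_near. Qed.

Lemma negl_row_mulmx n m (v : nat -> 'rV[R[i]]_n) (A : 'M[R[i]]_(n, m)) :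
  negl_row v -> negl_row (fun k => v k *m A).
Proof.
move=> hv j.
have h : negl rho (fun k => \sum_i normc (v k 0 i) * normc (A i j)).
  apply: negl_sum => i; apply: (negl_le (K := normc (A i j))) (hv i).
  by near=> k; rewrite normrM mulrC (ger0_norm (normc_ge0 (A i j))).
apply: (negl_le (K := 1)) h; near=> k.
rewrite mul1r !ger0_norm ?normc_ge0 ?sumr_ge0 //; last first.
  by move=> i _; rewrite mulr_ge0 ?normc_ge0.
rewrite mxE; elim/big_ind2: _.
- by rewrite ComplexField.Normc.normc0.
- by move=> a b c d ab cd; apply: le_trans (le_normcD _ _) _; exact: lerD.
- by move=> i _; rewrite ComplexField.Normc.normcM.
Unshelve. all: by end_near. Qed.

Lemma negl_rowZ n (K : R) (c : nat -> R[i]) (v : nat -> 'rV[R[i]]_n) :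
  (forall k, normc (c k) <= K) -> negl_row v -> negl_row (fun k => c k *: v k).
Proof.
move=> hc hv j; apply: (negl_le (K := K)) (hv j); near=> k.
rewrite mxE ComplexField.Normc.normcM normrM !(ger0_norm (normc_ge0 _)).
by rewrite ler_wpM2r ?normc_ge0.
Unshelve. all: by end_near. Qed.

Lemma negl_row_real n (v : nat -> 'rV[R]_n) :
  negl_row (fun k => map_mx (real_complex R) (v k)) <->
  forall j, negl rho (fun k => v k 0 j).
Proof.
split=> h j.
  apply: negl_norm; apply: (negl_le (K := 1)) (h j); near=> k.
  by rewrite !mxE normc_real mul1r normr_id.
apply: (negl_le (K := 1)) (norm_negl (h j)); near=> k.
by rewrite !mxE normc_real mul1r.
Unshelve. all: by end_near. Qed.

Variables (n : nat) (M : 'M[R]_n) (lam : R) (nu : 'rV[R]_n) (u : 'cV[R]_n).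
Hypothesis M0 : forall i j, 0 <= M i j.
Hypothesis irr : forall S : 'I_n -> Prop, (exists i, S i) ->
  (forall i j, S i -> 0 < M i j -> S j) -> forall j, S j.
Hypothesis lam01 : 0 < lam < 1.
Hypothesis nu0 : forall i, 0 <= nu 0 i.
Hypothesis nu1 : \sum_i nu 0 i = 1.
Hypothesis nuM : nu *m M = lam *: nu.
Hypothesis u_gt0 : forall i, 0 < u i 0.
Hypothesis Mu : M *m u = lam *: u.
Hypothesis nuu : nu *m u = 1%:M.

Let A := invmx (1%:M - M).
Let alpha := (1 - lam)^-1.

Let alpha0 : 0 < alpha.
Proof. by have /andP[_ l1] := lam01; rewrite invr_gt0 subr_gt0. Qed.

Let U : 1%:M - M \in unitmx.
Proof. exact: (unitmx_1B M0 lam01 u_gt0 Mu). Qed.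

Let A_comm : A *m M = M *m A.
Proof. exact: (invmx_comm M0 lam01 u_gt0 Mu). Qed.

Variables (b : nat -> R) (a eta : nat -> R) (lo hi : R).
Hypothesis b01 : forall k, 0 <= b k <= 1.
Hypothesis lo0 : 0 < lo.
Hypothesis alohi : \forall k \near \oo, lo <= a k <= hi.
Hypothesis aS : forall k,
  a k.+1 = a k * (1 - gamma k + gamma k * b k * alpha) + gamma k * eta k.
Hypothesis eta0 : eta @ \oo --> 0.

Local Notation C_ := (real_complex R).
Local Notation MC := (map_mx C_ M).
Local Notation AC := (map_mx C_ A).
Local Notation uC := (map_mx C_ u).

(* By Cayley-Hamilton the last factor of the spectrum annihilates [zeta]; going
   back through the list, [zeta (M - z)] negligible makes [zeta A] equal to
   [zeta / (1 - z)] up to a negligible term. *)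
Lemma factor_decay (s : seq R[i]) :
  (forall z, z \in s -> z = C_ lam \/
    [/\ 1 - z != 0, 0 <= complex.Re (1 / (1 - z)) &
        rho < 1 - (1 - lam) * complex.Re (1 / (1 - z))]) ->
  forall zeta xi : nat -> 'rV[R[i]]_n,
  (forall k, zeta k *m uC = 0) ->
  (forall k, zeta k.+1 = C_ (1 - gamma k) *: zeta k
     + C_ (gamma k * b k) *: (zeta k *m AC) + C_ (gamma k) *: xi k) ->
  negl_row xi ->
  negl_row (fun k => foldl (fun v z => v *m (MC - z%:M)) (zeta k) s) ->
  negl_row zeta.
Proof.
elim: s => [|z s IH] //= hs zeta xi zu zS xi0 hfold.
pose zeta' k := zeta k *m (MC - z%:M).
have AMC : AC *m (MC - z%:M) = (MC - z%:M) *m AC.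
  by rewrite mulmxBr mulmxBl -!map_mxM A_comm mul_mx_scalar mul_scalar_mx.
have z'0 : negl_row zeta'.
  apply: (IH _ zeta' (fun k => xi k *m (MC - z%:M))).
  - by move=> w ws; apply: hs; rewrite inE ws orbT.
  - move=> k; rewrite /zeta' -mulmxA mulmxBl mul_scalar_mx -map_mxM Mu.
    by rewrite map_mxZ -scalerBl -scalemxAr zu scaler0.
  - move=> k; rewrite /zeta' zS !mulmxDl -!scalemxAl -!mulmxA.
    by rewrite AMC.
  - exact: negl_row_mulmx.
  - exact: hfold.
(* For [z = lam] no dynamics is involved: on rows orthogonal to [u] the factor [M - lam] agrees with
   the invertible deflated matrix [G]. *)
have [zE|[z1 Re0 rhoz]] := hs z (mem_head _ _).
  pose G := M - lam%:M + u *m nu.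
  have GU : G \in unitmx by exact: unitmx_deflated.
  have GUC : map_mx C_ G \in unitmx by rewrite map_unitmx.
  have h k : zeta k = zeta' k *m invmx (map_mx C_ G).
    apply: (canRL (mulmxK GUC)).
    rewrite /zeta' zE /G map_mxD map_mxB map_scalar_mx map_mxM /=.
    by rewrite mulmxDr mulmxA zu mul0mx addr0.
  have := negl_row_mulmx (invmx (map_mx C_ G)) z'0.
  by congr negl_row; apply/funext => k; rewrite h.
pose mu : R[i] := 1 / (1 - z).
(* By [M A = A - 1], [zeta' A = (1 - z) zeta A - zeta]: on [zeta] the matrix [A] acts as the scalar
   [mu], up to the negligible [zeta']. *)
have zA k : zeta k *m AC = mu *: zeta k + mu *: (zeta' k *m AC).
  apply: (scalerI z1).
  rewrite -scalerDr scalerA mulrCA mulfV // mulr1 scale1r.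
  have MA : MC *m AC = AC - 1%:M.
    have h : (1%:M - M) *m A = 1%:M by rewrite mulmxV.
    have : M *m A = A - 1%:M by rewrite -h mulmxBl mul1mx opprB addrC subrK.
    by move/(congr1 (map_mx C_)); rewrite map_mxM map_mxB map_mx1.
  rewrite /zeta' -mulmxA mulmxBl MA mul_scalar_mx !mulmxBr mulmx1 -scalemxAr.
  by rewrite scalerBl scale1r addrAC addrCA subrr addr0.
pose xi' k := xi k + C_ (b k) *: (mu *: (zeta' k *m AC)).
have xi'0 : negl_row xi'.
  apply: negl_rowD => //; apply: (negl_rowZ (K := 1)).
    by move=> k; rewrite normc_real; have /andP[? ?] := b01 k; rewrite ger0_norm.
  by apply: (negl_rowZ (K := normc mu)) => //; exact: negl_row_mulmx.
move=> j; apply: (scalar_decay (xi := fun k => xi' k 0 j) g01 gdec tauoo gto0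
  alpha0 b01 lo0 alohi aS eta0 (mu := mu)) => //.
- by case/andP: rho01.
- by rewrite invrK mulrC.
- move=> k; rewrite zS zA rmorphM /= /xi'.
  have E (p q r x y w m : R[i]) : p * x + q * r * (m * x + m * y) + q * w =
      (p + q * r * m) * x + q * (w + r * (m * y)) by ring.
  move: (zeta' k *m AC) => w; rewrite 11!mxE E; congr (_ + _).
Qed.

End pathwise.

(** * Rate of convergence along one trajectory *)

Section pathwise_rate.
Variables (R : realType) (gamma : nat -> R).
Hypothesis g01 : forall n, 0 < gamma n < 1.
Hypothesis gdec : nonincreasing_seq gamma.
Hypothesis tauoo : tau gamma @ \oo --> +oo.
Hypothesis gto0 : gamma @ \oo --> 0.
Local Notation negl := (is_negl gamma).
Variables (n : nat) (M : 'M[R]_n) (lam : R) (nu : 'rV[R]_n).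
Hypothesis M0 : forall i j, 0 <= M i j.
Hypothesis irr : forall S : 'I_n -> Prop, (exists i, S i) ->
  (forall i j, S i -> 0 < M i j -> S j) -> forall j, S j.
Hypothesis lam01 : 0 < lam < 1.
Hypothesis nu0 : forall i, 0 <= nu 0 i.
Hypothesis nu1 : \sum_i nu 0 i = 1.
Hypothesis nuM : nu *m M = lam *: nu.
Let A := invmx (1%:M - M).
Local Notation C_ := (real_complex R).
Variable s : seq R[i].
Hypothesis spec : char_poly (map_mx C_ M) = \prod_(z <- s) ('X - z%:P).
Variables (x e N : nat -> 'rV[R]_n) (b : nat -> R).
Hypothesis b01 : forall k, 0 <= b k <= 1.
Hypothesis x0 : forall k j, 0 <= x k 0 j.
Hypothesis x1 : forall k, \sum_j x k 0 j = 1.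
Hypothesis e01 : forall k j, 0 <= e k 0 j <= 1.
Hypothesis xS : forall k, x k.+1 = (1 - gamma k) *: x k + gamma k *: e k.+1.
Hypothesis NS : forall k, N k.+1 = (1 - gamma k) *: N k +
  gamma k *: (e k.+1 *m A - e k *m (M *m A) - b k *: (x k *m A)).

(* [x] without its martingale and telescoping parts. *)
Fixpoint smoothed (k : nat) : 'rV[R]_n :=
  if k is k'.+1 then
    (1 - gamma k') *: smoothed k' + (gamma k' * b k') *: (x k' *m A)
  else x 0.

Lemma negl_mulmx rho m (v : nat -> 'rV[R]_n) (B : 'M[R]_(n, m)) :
  (forall j, negl rho (fun k => v k 0 j)) ->
  forall j, negl rho (fun k => (v k *m B) 0 j).
Proof.
move=> /negl_row_real/(negl_row_mulmx (map_mx C_ B)) h; apply/negl_row_real.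
by move: h; congr negl_row; apply/funext => k; rewrite map_mxM.
Qed.

Lemma mulmx_norm_le m (w : 'rV[R]_n) (B : 'M[R]_(n, m)) j :
  (forall i, 0 <= w 0 i <= 1) -> `|(w *m B) 0 j| <= \sum_i `|B i j|.
Proof.
move=> w01; rewrite mxE; apply: le_trans (ler_norm_sum _ _ _) _.
apply: ler_sum => i _; have /andP[w0 w1] := w01 i.
by rewrite normrM ger0_norm // ler_piMl.
Qed.

Let h k := e k *m (M *m A).
Let D k := x k - N k - smoothed k.

(** Since [(1 - M) A = 1], each [e k.+1] equals [e k.+1 A - h k.+1]; removing the noise and the
    smoothed part leaves the increments [gamma k * (h k - h k.+1)] with [h] bounded. *)
Lemma telescoping_part rho : 0 <= rho < 1 -> negl rho gamma ->
  forall j, negl rho (fun k => D k 0 j).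
Proof.
move=> rho01 ng j.
apply: (telescoping_negl g01 gdec tauoo rho01 ng
  (C := \sum_i `|(M *m A) i j|) (h := fun k => h k 0 j)).
  by move=> k; exact: mulmx_norm_le.
move=> k.
have U : 1%:M - M \in unitmx.
  have [u [u_gt0 Mu _]] := right_eigenvector_gt0 M0 irr lam01 nu0 nu1 nuM.
  exact: (unitmx_1B M0 lam01 u_gt0 Mu).
have eE : e k.+1 = e k.+1 *m A - h k.+1.
  rewrite /h mulmxA -mulmxA -mulmxBr -[X in X - _]mul1mx -mulmxBl mulmxV //.
  by rewrite mulmx1.
have -> : D k.+1 = (1 - gamma k) *: D k + gamma k *: (h k - h k.+1).
  rewrite /D xS NS /= {1}eE -/(h k).
  by apply/rowP => i; rewrite !mxE; ring.
by rewrite !mxE.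
Qed.

(** [x] splits into [smoothed] plus a negligible [W]. The [u]-coordinate of [smoothed] is the
    positive sequence [a], its projection by [Q] decays by [factor_decay], and the unit mass of [x]
    recovers the remaining direction. *)
Theorem pathwise_rate rho : 0 <= rho < 1 -> negl rho gamma ->
  (forall z, z \in s -> z = C_ lam \/
    [/\ 1 - z != 0, 0 <= complex.Re (1 / (1 - z)) &
        rho < 1 - (1 - lam) * complex.Re (1 / (1 - z))]) ->
  (forall j, negl rho (fun k => N k 0 j)) ->
  forall j, negl rho (fun k => x k 0 j - nu 0 j).
Proof.
move=> rho01 ng hs hN.
have [u [u_gt0 Mu nuu]] := right_eigenvector_gt0 M0 irr lam01 nu0 nu1 nuM.
have hD := telescoping_part rho01 ng.
pose W k := N k + D k.
have hW j : negl rho (fun k => W k 0 j).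
  have := neglD (hN j) (hD j); congr is_negl.
  by apply/funext => k; rewrite [in RHS]mxE.
pose y := smoothed.
have yE k : y k = x k - W k.
  by rewrite /W /D /y; apply/rowP => i; rewrite !mxE; ring.
pose alpha := (1 - lam)^-1.
have Au : A *m u = alpha *: u.
  exact: (invmx_right_eigenvector M0 lam01 u_gt0 Mu).
have nuA : nu *m A = alpha *: nu.
  exact: (invmx_left_eigenvector M0 lam01 nuM u_gt0 Mu).
pose a k := (y k *m u) 0 0.
(* The error made by replacing [x] with [y] in the recursion along [u]. *)
pose eta k := b k * alpha * (W k *m u) 0 0.
have hWu : negl rho (fun k => (W k *m u) 0 0) by exact: negl_mulmx.
have eta0 : eta @ \oo --> 0.
  apply: (negl_cvg0 (rho := rho) g01); first by case/andP: rho01.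
  apply: (neglM (K := `|alpha|)) hWu => k; rewrite normrM.
  have /andP[bk0 bk1] := b01 k.
  by rewrite ger0_norm // ler_piMl.
have aS k : a k.+1 = a k * (1 - gamma k + gamma k * b k * alpha) + gamma k * eta k.
  have xu : (x k *m A *m u) 0 0 = alpha * (a k + (W k *m u) 0 0).
    rewrite -mulmxA Au -scalemxAr mxE; congr (_ * _).
    have -> : x k = y k + W k by rewrite yE subrK.
    by rewrite mulmxDl mxE.
  rewrite /eta /a [y k.+1]/= mulmxDl -!scalemxAl mxE [X in X + _]mxE.
  rewrite [X in _ + X = _]mxE xu /a /y; ring.
(* A positive lower bound of all entries of [u], built without a minimum over a possibly empty index
   set. *)
pose lo0 := (1 + \sum_i (u i 0)^-1)^-1.
have s0 : 0 < 1 + \sum_i (u i 0)^-1.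
  rewrite ltr_pwDl //; apply: sumr_ge0 => i _; rewrite invr_ge0; exact: ltW.
have lo00 : 0 < lo0 by rewrite invr_gt0.
have lo_le i : lo0 <= u i 0.
  rewrite -[u i 0]invrK lef_pV2 ?posrE ?invr_gt0 // (bigD1 i) //= addrA.
  rewrite addrAC lerDr addr_ge0 //; apply: sumr_ge0 => l _.
  by rewrite invr_ge0; exact: ltW.
pose hi0 := \sum_i u i 0.
have hi_le i : u i 0 <= hi0.
  by rewrite /hi0 (bigD1 i) //= lerDl; apply: sumr_ge0 => l _; exact: ltW.
have xu k : lo0 <= (x k *m u) 0 0 <= hi0.
  rewrite mxE -[lo0]mul1r -[hi0]mul1r -(x1 k) !mulr_suml.
  by apply/andP; split; apply: ler_sum => i _; rewrite ler_wpM2l.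
(* Unit mass puts [x u] in [[lo0, hi0]], and [W u] eventually moves it by less than [lo0 / 2]. *)
have alohi : \forall k \near \oo, lo0 / 2 <= a k <= hi0 + lo0 / 2.
  have : (fun k => (W k *m u) 0 0) @ \oo --> 0.
    by apply: (negl_cvg0 (rho := rho) g01); first by case/andP: rho01.
  move/cvgr0Pnorm_lt => /(_ (lo0 / 2)); rewrite divr_gt0 // => /(_ isT).
  apply: filterS => k.
  have -> : a k = (x k *m u) 0 0 - (W k *m u) 0 0.
    by rewrite /a yE mulmxBl mxE [X in _ + X]mxE.
  have /andP[? ?] := xu k.
  by rewrite ltr_norml => /andP[? ?]; apply/andP; split; lra.
(* Acting on rows, the projector along [nu] onto the rows orthogonal to [u]. *)
pose Q := 1%:M - u *m nu.
have AQ : A *m Q = Q *m A.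
  rewrite /Q mulmxBr mulmxBl mulmx1 mul1mx mulmxA Au -mulmxA nuA.
  by rewrite -scalemxAl -scalemxAr.
have Qu : Q *m u = 0 by rewrite /Q mulmxBl mul1mx -mulmxA nuu mulmx1 subrr.
pose z k := y k *m Q.
have hz j : negl rho (fun k => z k 0 j).
  move: j; apply/negl_row_real.
  apply: (factor_decay g01 gdec tauoo gto0 rho01 M0 irr lam01 nu0 nu1 nuM
    u_gt0 Mu nuu b01 _ alohi aS eta0 hs
    (xi := fun k => map_mx C_ (b k *: (W k *m (A *m Q))))).
  - by rewrite divr_gt0.
  - by move=> k; rewrite -map_mxM /z -mulmxA Qu mulmx0 map_mx0.
  - move=> k; rewrite -map_mxM -!map_mxZ -!map_mxD; congr map_mx.
    rewrite /z [y k.+1]/= -/(y k) mulmxDl -!scalemxAl -addrA; congr (_ + _).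
    have -> : x k = y k + W k by rewrite yE subrK.
    by rewrite scalerA -scalerDr !mulmxDl -!mulmxA AQ.
  - apply/negl_row_real => j.
    have := neglM (K := 1) _ (negl_mulmx (A *m Q) hW j) => /(_ b).
    have hb k : `|b k| <= 1 by have /andP[? ?] := b01 k; rewrite ger0_norm.
    move/(_ hb); congr is_negl; apply/funext => k; by rewrite [RHS]mxE.
  (* Over the whole spectrum the fold is exactly zero, hence the constant [K := 0]. *)
  - have := @Cayley_Hamilton_foldl _ _ _ _ spec => CH j.
    apply: (negl_le (K := 0)) (negl0 gamma rho); near=> k.
    by rewrite CH mxE ComplexField.Normc.normc0 normr0 mul0r.
pose q k := x k *m Q.
have hq j : negl rho (fun k => q k 0 j).
  have := neglD (hz j) (negl_mulmx Q hW j); congr is_negl.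
  apply/funext => k; rewrite /q; have -> : x k = y k + W k by rewrite yE subrK.
  by rewrite (mulmxDl (y k)) [RHS]mxE.
(* Both [x k] and [nu] have mass 1, so the entries of [q k] sum to [1 - x k u], which gives the
   missing coefficient along [nu]. *)
have xE k j : x k 0 j - nu 0 j = q k 0 j - nu 0 j * \sum_i q k 0 i.
  have qE i : q k 0 i = x k 0 i - (x k *m u) 0 0 * nu 0 i.
    rewrite /q /Q mulmxBr mulmx1 mulmxA [x k *m u]mx11_scalar mul_scalar_mx.
    by rewrite !mxE eqxx mulr1n.
  under [X in _ * X]eq_bigr do rewrite qE.
  rewrite sumrB -mulr_sumr x1 nu1 qE; ring.
move=> j; have hS : negl rho (fun k => - nu 0 j * \sum_i q k 0 i).
  by apply: (neglM (K := `|nu 0 j|)) (negl_sum _ hq) => k; rewrite normrN.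
have := neglD (hq j) hS; congr is_negl.
by apply/funext => k; rewrite xE mulNr.
Unshelve. all: by end_near. Qed.

End pathwise_rate.

(** * Exponential moments of the averaged noise *)

Section finite_valued_process.
Variables (R : realType) (T : finType) (d : measure_display)
  (Omega : measurableType d) (Pr : probability Omega R) (X : nat -> Omega -> T).
Hypothesis mX : forall n j, measurable (X n @^-1` [set j]).

(** Pathwise form of measurability with respect to the history: the value depends on [X 0, ..., X n]
    only. *)
Definition adapted (S : Type) (n : nat) (G : Omega -> S) :=
  forall w w', (forall k, (k <= n)%N -> X k w = X k w') -> G w = G w'.

Lemma adapted_comp S S' n (f : S -> S') (G : Omega -> S) :
  adapted n G -> adapted n (fun w => f (G w)).
Proof. by move=> hG w w' h; rewrite (hG w w'). Qed.

(** The sets that do not separate paths agreeing up to [n] form a sigma-algebra containing the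
    generators. *)
Lemma history_saturated n (A : set Omega) : history X n A ->
  forall w w', (forall k, (k <= n)%N -> X k w = X k w') -> A w -> A w'.
Proof.
move: A; apply: smallest_sub => [|A [k [j [kn ->]]] w w' h /= <-]; last first.
  by rewrite h.
split=> [//|A hA w w' h [_ nAw]|A hA w w' h [k _ Akw]].
  by split=> // Aw'; apply: nAw; apply: hA Aw' => k kn; rewrite h.
by exists k => //; apply: hA Akw.
Qed.

Lemma measurable_wrt_adapted n (Y : Omega -> R) :
  measurable_wrt (history X n) Y -> adapted n Y.
Proof.
move=> mY w w' h; have hY : history X n (Y @^-1` [set Y w]) by exact: mY.
by apply: esym; exact: (history_saturated hY h).
Qed.

Definition cylinder n (a : nat -> T) : set Omega :=
  [set w | forall k, (k <= n)%N -> X k w = a k].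

Lemma history_cylinder n a : history X n (cylinder n a).
Proof.
have [s0 sC sU] := smallest_sigma_algebra setT
  [set A | exists k j, (k <= n)%N /\ A = X k @^-1` [set j]].
have sT : history X n setT by rewrite -[setT]setD0; exact: sC.
(* Padding with [setT] beyond [n] makes the finite intersection countable; complements and unions
   then express it. *)
pose B k := if (k <= n)%N then X k @^-1` [set a k] else setT.
have -> : cylinder n a = setT `\` \bigcup_k (setT `\` B k).
  apply/seteqP; split => w /=.
    move=> h; split => // -[k _ [_]]; apply; rewrite /B.
    by case: leqP => // kn; exact: h.
  move=> [_ h] k kn; apply: contrapT => hk; apply: h; exists k => //; split=> //.
  by rewrite /B kn.
apply: (sC); apply: sU => k; apply: (sC); rewrite /B; case: leqP => // kn.
by apply: sub_sigma_algebra; exists k, (a k).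
Qed.

Lemma history_measurable n (A : set Omega) : history X n A -> measurable A.
Proof.
move: A; apply: smallest_sub => [|A [k [j [kn ->]]]]; last exact: mX.
split; first exact: measurable0.
  by move=> A mA; apply: measurableD => //; exact: measurableT.
by move=> A mA; exact: bigcup_measurable.
Qed.

Let path n := {ffun 'I_n.+1 -> T}.

Let at_path n (a : path n) : set Omega := cylinder n (fun k => a (inord k)).

Let m_at_path n (a : path n) : measurable (at_path a).
Proof.
exact: (history_measurable (@history_cylinder n (fun k => a (inord k)))).
Qed.

Let at_pathE n (a : path n) w : at_path a w -> a = [ffun k : 'I_n.+1 => X k w].
Proof.
move=> h; apply/ffunP => k; rewrite ffunE h ?inord_val //.
by rewrite -ltnS ltn_ord.
Qed.

Let at_path_path n w : at_path [ffun k : 'I_n.+1 => X k w] w.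
Proof. by move=> k kn; rewrite ffunE inordK. Qed.

Let at_path_adapted n S (G : Omega -> S) (a : path n) w w' :
  adapted n G -> at_path a w -> at_path a w' -> G w = G w'.
Proof. by move=> hG hw hw'; apply: hG => k kn; rewrite hw ?hw'. Qed.

(** [G] takes one value per path up to [n], so a preimage is a finite union of cylinders. *)
Lemma adapted_measurable n (G : Omega -> R) :
  adapted n G -> measurable_fun setT G.
Proof.
move=> hG _ B mB; rewrite setTI.
have -> : G @^-1` B =
    \bigcup_(a in [set a : path n | exists2 w, at_path a w & B (G w)]) at_path a.
  apply/seteqP; split => [w /= Bw|w [a [w' aw' Bw'] aw]].
    by exists [ffun k : 'I_n.+1 => X k w] => //; exists w.
  by rewrite /= (at_path_adapted hG aw aw').
apply: fin_bigcup_measurable => [|a _]; first exact: finite_finset.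
exact: m_at_path.
Qed.

Lemma integral_paths n (f : Omega -> R) :
  measurable_fun setT f -> (forall w, 0 <= f w) ->
  (\int[Pr]_w (f w)%:E = \sum_(a : path n) \int[Pr]_(w in at_path a) (f w)%:E)%E.
Proof.
move=> mf f0.
have UT : \big[setU/set0]_(a <- index_enum (path n)) at_path a = setT.
  rewrite -bigcup_seq; apply/seteqP; split => // w _.
  by exists [ffun k : 'I_n.+1 => X k w] => //=; exact: mem_index_enum.
rewrite -{1}UT ge0_integral_bigsetU //=.
- exact: index_enum_uniq.
- by move=> a b _ _ [w [/at_pathE -> /at_pathE ->]].
- by rewrite UT; exact/measurable_EFinP.
- by move=> w _; rewrite lee_fin.
Qed.

(** Partition by the paths up to [n]: on each cylinder [G] is constant, and the cylinder lies in the
    history, so the defining identity of the conditional probability applies there. *)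
Lemma integral_cond_prob n (j : T) (G Y : Omega -> R) :
  adapted n G -> (forall w, 0 <= G w) -> (forall w, 0 <= Y w) ->
  is_cond_prob Pr (history X n) (X n.+1 @^-1` [set j]) Y ->
  (\int[Pr]_w (G w * \1_(X n.+1 @^-1` [set j]) w)%:E =
   \int[Pr]_w (G w * Y w)%:E)%E.
Proof.
move=> hG G0 Y0 [mY _ iY]; have hY := measurable_wrt_adapted mY.
have m1 : measurable_fun setT (fun w => \1_(X n.+1 @^-1` [set j]) w : R).
  exact: measurable_indic.
have mG := adapted_measurable hG; have mY' := adapted_measurable hY.
rewrite !(@integral_paths n); last first.
- by move=> w; rewrite mulr_ge0.
- exact: measurable_funM.
- by move=> w; rewrite mulr_ge0.
- exact: measurable_funM.
apply: eq_bigr => a _.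
have ma : measurable (at_path a) by exact: m_at_path.
(* A nonempty cylinder provides the point [w0] at which the constant value of [G] is read. *)
have [->|/set0P[w0 aw0]] := eqVneq (at_path a) set0.
  by rewrite !integral_set0.
transitivity (\int[Pr]_(w in at_path a)
    ((G w0)%:E * (\1_(X n.+1 @^-1` [set j]) w)%:E))%E.
  apply: eq_integral => w /set_mem aw; rewrite EFinM.
  by rewrite (at_path_adapted hG aw aw0).
transitivity (\int[Pr]_(w in at_path a) ((G w0)%:E * (Y w)%:E))%E; last first.
  apply: eq_integral => w /set_mem aw; rewrite EFinM.
  by rewrite (at_path_adapted hG aw aw0).
have mfin f : measurable_fun setT f ->
    measurable_fun (at_path a) (fun w => (f w)%:E : \bar R).
  by move=> mf; apply/measurable_EFinP; exact: measurable_funTS.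
rewrite (ge0_integralZl_EFin _ ma _ (mfin _ m1) (G0 w0)); last first.
  by move=> w _; rewrite lee_fin.
rewrite (ge0_integralZl_EFin _ ma _ (mfin _ mY') (G0 w0)); last first.
  by move=> w _; rewrite lee_fin.
rewrite integral_indic // iY //.
exact: (@history_cylinder n (fun k => a (inord k))).
Qed.

End finite_valued_process.

(** * Averaged martingale noise *)

Section noise.
Variables (R : realType) (T : finType) (d : measure_display)
  (Omega : measurableType d) (Pr : probability Omega R) (X : nat -> Omega -> T).
Hypothesis mX : forall n j, measurable (X n @^-1` [set j]).
Variables (gamma : nat -> R) (K : nat -> Omega -> T -> R).
Hypothesis K0 : forall n w j, 0 <= K n w j.
Hypothesis K1 : forall n w, \sum_j K n w j = 1.
Hypothesis adK : forall n, adapted X n (K n).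
Hypothesis condK : forall n j,
  is_cond_prob Pr (history X n) (X n.+1 @^-1` [set j]) (fun w => K n w j).

(** Martingale differences of [g] averaged by the recursion of [x]. With [g] a column of [A] it is
    one coordinate of the row [N] of the pathwise analysis. *)
Fixpoint noise (g : T -> R) (n : nat) (w : Omega) : R :=
  if n is m.+1 then
    (1 - gamma m) * noise g m w +
    gamma m * (g (X m.+1 w) - \sum_j K m w j * g j)
  else 0.

(* Variance proxy of [noise], for increments bounded by 1. *)
Fixpoint noise_var (n : nat) : R :=
  if n is m.+1 then (1 - gamma m) ^+ 2 * noise_var m + gamma m ^+ 2 else 0.

Lemma adapted_noise g n : adapted X n (noise g n).
Proof.
elim: n => [|n IH] w w' h //=.
rewrite (IH w w') ?(h n.+1) //; last by move=> k kn; apply: h; exact: leqW.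
by rewrite (adK (w := w) (w' := w')) // => k kn; apply: h; exact: leqW.
Qed.

Lemma noiseN g n w : noise (fun j => - g j) n w = - noise g n w.
Proof.
elim: n => [|n IH] /=; first by rewrite oppr0.
rewrite IH; have -> : \sum_j K n w j * - g j = - \sum_j K n w j * g j.
  by rewrite -sumrN; apply: eq_bigr => j _; rewrite mulrN.
by ring.
Qed.

Lemma centered_le g n w j : `|g j - \sum_i K n w i * g i| <= 2 * \sum_i `|g i|.
Proof.
apply: (le_trans (ler_normB _ _)); rewrite mulrDl mul1r lerD //.
  by rewrite (bigD1 j) //= lerDl sumr_ge0.
apply: (le_trans (ler_norm_sum _ _ _)); apply: ler_sum => i _.
rewrite normrM ger0_norm // ler_piMl // -(K1 n w) (bigD1 i) //= lerDl.
by rewrite sumr_ge0.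
Qed.

(** The induction is for all [theta] at once, since a step turns [theta] into
    [theta * (1 - gamma n)]. Given the past, the last increment contributes at most [V]: the linear
    term of [expR_le_addx] has mean zero. *)
Lemma noise_mgf g C theta n :
  (forall n w j, `|g j - \sum_i K n w i * g i| <= C) ->
  (\int[Pr]_w (expR (theta * noise g n w))%:E <=
   (expR (2 * theta ^+ 2 * C ^+ 2 * noise_var n))%:E)%E.
Proof.
move=> hC; elim: n theta => [|n IH] theta.
  rewrite /= !mulr0 expR0.
  by rewrite integral_cst // mul1e; exact: probability_le1.
pose c w := \sum_i K n w i * g i.
pose E w := expR (theta * (1 - gamma n) * noise g n w).
(* The exponential with the next state frozen at [j]: it is adapted at time [n], so the indicator of
   [X n.+1 = j] can be replaced by [K n w j]. *)
pose G j w := E w * expR (theta * gamma n * (g j - c w)).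
have adc : adapted X n c.
  exact: (adapted_comp (fun k => \sum_i k i * g i)).
have adE : adapted X n E.
  exact: (adapted_comp (fun t => expR (theta * (1 - gamma n) * t))
    (@adapted_noise g n)).
have adG j : adapted X n (G j).
  by move=> w w' h; rewrite /G (adE w w') // (adc w w').
have G0 j w : 0 <= G j w by rewrite mulr_ge0 ?expR_ge0.
apply: (@le_trans _ _
    (\sum_j \int[Pr]_w (G j w * \1_(X n.+1 @^-1` [set j]) w)%:E)%E).
  rewrite -ge0_integral_sum //=; first last.
  - by move=> j w _; rewrite lee_fin mulr_ge0.
  - move=> j; apply/measurable_EFinP; apply: measurable_funM.
      exact: (adapted_measurable mX (adG j)).
    exact: measurable_indic.
  rewrite le_eqVlt; apply/orP; left; apply/eqP; apply: eq_integral => w _.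
  rewrite sumEFin.
  have -> : \sum_j G j w * \1_(X n.+1 @^-1` [set j]) w = G (X n.+1 w) w.
    rewrite (bigD1 (X n.+1 w)) //= big1 => [|j jX]; last first.
      rewrite indicE memNset ?mulr0 //= => h.
      by move: jX; rewrite h eqxx.
    by rewrite indicE mem_set // mulr1 addr0.
  rewrite /G /E -expRD /c /=; congr (expR _)%:E; ring.
under eq_bigr do rewrite (integral_cond_prob mX (adG _) (G0 _) _ (condK _ _)) //.
rewrite -ge0_integral_sum //=; first last.
- by move=> j w _; rewrite lee_fin mulr_ge0.
- move=> j; apply/measurable_EFinP; apply: (@adapted_measurable _ _ _ _ _ mX n).
  by move=> w w' h; rewrite (adG j w w') // (adK (w := w) (w' := w')).
pose V := expR (2 * theta ^+ 2 * C ^+ 2 * gamma n ^+ 2).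
apply: (@le_trans _ _ (\int[Pr]_w (V%:E * (E w)%:E))%E).
  apply: ge0_le_integral => //=.
  - by move=> w _; rewrite sumEFin lee_fin sumr_ge0 // => j _; rewrite mulr_ge0.
  - under eq_fun do rewrite sumEFin.
    apply/measurable_EFinP; apply: (@adapted_measurable _ _ _ _ _ mX n).
    move=> w w' h; apply: eq_bigr => j _.
    by rewrite (adG j w w') // (adK (w := w) (w' := w')).
  - under eq_fun do rewrite -EFinM.
    apply/measurable_EFinP; apply: (@adapted_measurable _ _ _ _ _ mX n).
    exact: (adapted_comp (fun t => V * t) adE).
  - move=> w _; rewrite sumEFin -EFinM lee_fin /G.
    pose y j := theta * gamma n * (g j - c w).
    have yV j : expR (y j) <= y j + V.
      apply: (le_trans (expR_le_addx _)); rewrite lerD2l ler_expR.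
      have -> : 2 * theta ^+ 2 * C ^+ 2 * gamma n ^+ 2 =
        2 * ((theta * gamma n) ^+ 2 * C ^+ 2) by ring.
      rewrite ler_wpM2l // /y exprMn ler_wpM2l ?sqr_ge0 //.
      have C0 : 0 <= C by exact: le_trans (hC n w j).
      rewrite -(real_normK (num_real (g j - c w))) ler_pXn2r ?nnegrE //.
      exact: hC.
    have Ky : \sum_j K n w j * y j = 0.
      have -> : \sum_j K n w j * y j =
          theta * gamma n * (\sum_j K n w j * g j - c w * \sum_j K n w j).
        rewrite mulrBr !mulr_sumr -sumrB; apply: eq_bigr => j _; rewrite /y; ring.
      by rewrite K1 mulr1 subrr mulr0.
    apply: (@le_trans _ _ (\sum_j E w * (K n w j * y j + V * K n w j))).
      apply: ler_sum => j _; rewrite -mulrA ler_wpM2l ?expR_ge0 //.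
      rewrite [V * _]mulrC -mulrDr [leLHS]mulrC ler_wpM2l //.
      exact: yV.
    by rewrite -mulr_sumr big_split /= Ky add0r -mulr_sumr K1 mulr1 mulrC.
rewrite ge0_integralZl_EFin //=; first last.
- exact: expR_ge0.
- by apply/measurable_EFinP; exact: (adapted_measurable mX adE).
- by move=> w _; rewrite lee_fin expR_ge0.
apply: (@le_trans _ _ (V%:E * (expR (2 * (theta * (1 - gamma n)) ^+ 2 *
    C ^+ 2 * noise_var n))%:E)%E).
  by apply: lee_wpmul2l; [rewrite lee_fin expR_ge0|exact: IH].
rewrite -EFinM lee_fin -expRD ler_expR le_eqVlt; apply/orP; left; apply/eqP.
by ring.
Qed.

End noise.

(** * Almost sure decay of the noise *)

(** Integrating term by term bounds the integral of the whole series by [B]; an integrable series is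
    almost surely finite. *)
Lemma ae_bounded_sums (R : realType) (d : measure_display)
    (Omega : measurableType d) (Pr : probability Omega R)
    (Y : nat -> Omega -> R) (c : nat -> R) (B : R) :
  (forall n, measurable_fun setT (Y n)) -> (forall n w, 0 <= Y n w) ->
  (forall n, (\int[Pr]_w (Y n w)%:E <= (c n)%:E)%E) ->
  (forall n, \sum_(0 <= i < n) c i <= B) ->
  {ae Pr, forall w, exists M, forall n, \sum_(0 <= i < n) Y i w <= M}.
Proof.
move=> mY Y0 hc hB.
pose f w := (\sum_(0 <= i <oo) (Y i w)%:E)%E.
have mE n : measurable_fun setT (fun w => (Y n w)%:E).
  exact/measurable_EFinP.
have f0 w : (0 <= f w)%E by apply: nneseries_ge0 => i _ _; rewrite lee_fin.
have mf : measurable_fun setT f.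
  apply: (@ge0_emeasurable_sum _ _ _ setT (fun i w => (Y i w)%:E) xpredT) => //.
  by move=> k w _ _; rewrite lee_fin.
have If : Pr.-integrable setT f.
  apply/integrableP; split => //.
  under eq_integral do rewrite gee0_abs //.
  rewrite /f integral_nneseries //; last by move=> n w _; rewrite lee_fin.
  apply: (@le_lt_trans _ _ B%:E); last exact: ltey.
  apply: lime_le.
    apply: is_cvg_nneseries => n _ _; apply: integral_ge0 => w _.
    by rewrite lee_fin.
  near=> n; apply: (@le_trans _ _ (\sum_(0 <= i < n) (c i)%:E)%E).
    exact: lee_sum.
  by rewrite sumEFin lee_fin.
have := integrable_ae measurableT If; apply: filterS => w /(_ Logic.I) fw.
exists (fine (f w)) => n; rewrite -lee_fin fineK // -sumEFin.
by apply: nneseries_lim_ge => i _ _; rewrite lee_fin.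
Unshelve. all: by end_near. Qed.

Section occupation.
Variables (R : realType) (gamma : nat -> R).
Hypothesis g01 : forall n, 0 < gamma n < 1.
Hypothesis gdec : nonincreasing_seq gamma.
Hypothesis tauoo : tau gamma @ \oo --> +oo.

Let g0 n : 0 < gamma n. Proof. by have /andP[] := g01 n. Qed.

(* [N] moves by at most [C * gamma k] at step [k], so an excursion of [W * N]
   above [2] stays above [1] for a [tau]-time [(C * W)^-1]: it contributes at
   least [C^-1] to the sum of [gamma * W] over the times where [W * N >= 1]. *)
Lemma occupation_bound (C : R) (W N y : nat -> R) n0 : 0 < C ->
  (forall n, 0 < W n) -> {homo W : m n / (m <= n)%N >-> m <= n} ->
  (forall n, `|N n.+1 - N n| <= C * gamma n) ->
  (forall n, 0 <= y n) ->
  (forall n, (n0 <= n)%N -> 1 <= W n * N n -> gamma n * W n <= y n) ->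
  (exists M, forall n, \sum_(0 <= i < n) y i <= M) ->
  \forall n \near \oo, W n * N n <= 2.
Proof.
move=> C0 W0 Wle NS y0 hy [M hM].
pose S n := \sum_(0 <= i < n) y i.
have Sle : {homo S : m n / (m <= n)%N >-> m <= n}.
  move=> m n mn; rewrite /S [leRHS](big_cat_nat (n := m)) //= lerDl.
  by apply: sumr_ge0.
have Sc : cvgn S.
  by apply: nondecreasing_is_cvgn => //; exists M => _ [n _ <-]; exact: hM.
have Sl := nondecreasing_cvgn_le Sle Sc.
(* Beyond [n1] the remaining sum is below [C^-1], less than what one excursion contributes. *)
have [n1 _ hn1] : \forall n \near \oo, limn S - C^-1 < S n.
  by move/cvgrPdist_lt : Sc => /(_ C^-1); rewrite invr_gt0 => /(_ C0);
    apply: filterS => n; rewrite ltr_norml => /andP[? ?]; lra.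
exists (maxn n0 n1) => // n /=; rewrite geq_max => /andP[n0n n1n].
rewrite leNgt; apply/negP => WN2.
pose g m := \sum_(n <= k < m) gamma k.
have gS m : (n <= m)%N -> g m.+1 = g m + gamma m.
  by move=> nm; rewrite /g big_nat_recr.
have N_ge m : (n <= m)%N -> N n - C * g m <= N m.
  move=> /subnKC <-; elim: (m - n)%N => [|k IH].
    by rewrite addn0 /g big_geq // mulr0 subr0.
  rewrite addnS gS ?leq_addr //; have := NS (n + k)%N.
  by rewrite ler_norml => /andP[? ?]; lra.
have g_ge m : (n <= m)%N -> tau gamma m - tau gamma n <= g m.
  move=> /subnKC <-; elim: (m - n)%N => [|k IH].
    by rewrite addn0 subrr /g big_geq.
  rewrite addnS gS ?leq_addr //.
  have := tau_step gdec (n + k)%N; lra.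
have goo : exists m, (n <= m)%N && ((W n)^-1 < C * g m).
  have /cvgryPgt/(_ (tau gamma n + (W n)^-1 / C)) := tauoo.
  move=> [m _ hm]; exists (maxn m n); rewrite leq_maxr /=.
  rewrite mulrC -ltr_pdivrMr //.
  have := hm (maxn m n) (leq_maxl _ _); have := g_ge (maxn m n) (leq_maxr _ _).
  by move=> /= ? ?; lra.
(* The first time at which [C] times the accumulated steps exceeds [1 / W n]; before it [N] stays
   above [2 / W n - 1 / W n]. *)
pose m := ex_minn goo.
have [nm gm mmin] : [/\ (n <= m)%N, (W n)^-1 < C * g m &
    forall k, (n <= k)%N -> (k < m)%N -> C * g k <= (W n)^-1].
  rewrite /m; case: ex_minnP => m' /andP[? ?] hmin; split=> // k nk km.
  rewrite leNgt; apply/negP => h; have := hmin k; rewrite nk h => /(_ isT).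
  by rewrite leqNgt km.
have WN k : (n <= k)%N -> (k < m)%N -> gamma k * W n <= y k.
  move=> nk km; have Wk := Wle _ _ nk.
  apply: (@le_trans _ _ (gamma k * W k)); first by rewrite ler_wpM2l // ltW.
  apply: hy; first exact: leq_trans nk.
  have h1 : (W n)^-1 <= N k.
    have h2 : 2 * (W n)^-1 < N n by rewrite ltr_pdivrMr // mulrC.
    by have := N_ge _ nk; have := mmin k nk km; lra.
  apply: (@le_trans _ _ (W n * N k)).
    by rewrite mulrC -ler_pdivrMr // div1r.
  rewrite ler_wpM2r //; apply: le_trans h1.
  by rewrite invr_ge0 ltW.
have Sm : W n * g m <= S m - S n.
  rewrite /S (big_cat_nat (n := n)) //= addrAC subrr add0r /g mulr_sumr.
  rewrite !big_nat; apply: ler_sum => k /andP[nk km].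
  by rewrite mulrC; exact: WN.
have : C^-1 < W n * g m.
  rewrite -[C^-1]mul1r ltr_pdivrMr // -mulrA [g m * C]mulrC.
  by rewrite -[X in X < _](mulfV (lt0r_neq0 (W0 n))) ltr_pM2l.
have := hn1 n n1n; have := Sl m; rewrite /=; lra.
Unshelve. all: by end_near. Qed.

End occupation.

(** * Chernoff bounds for the noise in the time scale [tau] *)

Section noise_decay.
Variables (R : realType) (T : finType) (d : measure_display)
  (Omega : measurableType d) (Pr : probability Omega R) (X : nat -> Omega -> T).
Hypothesis mX : forall n j, measurable (X n @^-1` [set j]).
Variables (gamma : nat -> R) (K : nat -> Omega -> T -> R).
Hypothesis g01 : forall n, 0 < gamma n < 1.
Hypothesis gdec : nonincreasing_seq gamma.
Hypothesis tauoo : tau gamma @ \oo --> +oo.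
Hypothesis K0 : forall n w j, 0 <= K n w j.
Hypothesis K1 : forall n w, \sum_j K n w j = 1.
Hypothesis adK : forall n, adapted X n (K n).
Hypothesis condK : forall n j,
  is_cond_prob Pr (history X n) (X n.+1 @^-1` [set j]) (fun w => K n w j).
Local Notation tau := (tau gamma).
Local Notation negl := (is_negl gamma).
Local Notation noise := (noise X gamma K).
Local Notation s := (noise_var gamma).

Variable rho : R.
Hypothesis rho01 : 0 <= rho < 1.

(* Chosen so that [gamma * exp (rho * tau) * exp (- log_weight)] is summable. *)
Definition log_weight (n : nat) : R := 1 + rho * tau n + 2 * ln (1 + tau n).

Hypothesis negl_gammaL : negl (2 * rho) (fun n => gamma n * log_weight n).

Let g0 n : 0 < gamma n. Proof. by have /andP[] := g01 n. Qed.

Let t0 n : 0 <= tau n. Proof. exact: tau_ge0. Qed.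

Let rho0 : 0 <= rho. Proof. by case/andP: rho01. Qed.

Let rhotau0 n : 0 <= rho * tau n. Proof. exact: mulr_ge0. Qed.

Let lnt0 n : 0 <= ln (1 + tau n).
Proof. by rewrite ln_ge0 // lerDl. Qed.

Let L1 n : 1 <= log_weight n.
Proof. by rewrite /log_weight -addrA lerDl addr_ge0 // mulr_ge0. Qed.

Let L0 n : 0 <= log_weight n. Proof. exact: le_trans (L1 n). Qed.

Lemma log_weight_step n :
  log_weight n.+1 <= log_weight n + (rho + 2) * gamma n.
Proof.
have h := tau_step gdec n.
have p : 0 < 1 + tau n by rewrite ltr_pwDl.
have h1 : rho * tau n.+1 <= rho * tau n + rho * gamma n.
  by rewrite -mulrDr ler_wpM2l.
have h2 : ln (1 + tau n.+1) <= ln (1 + tau n) + gamma n.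
  have -> : 1 + tau n.+1 = (1 + tau n) * (1 + (tau n.+1 - tau n) / (1 + tau n)).
    by field; rewrite gt_eqF.
  have d0 : 0 <= tau n.+1 - tau n by rewrite subr_ge0 le_tau.
  have q0 : 0 <= (tau n.+1 - tau n) / (1 + tau n) by rewrite divr_ge0 // ltW.
  rewrite lnM ?posrE //; last by rewrite ltr_pwDl.
  rewrite lerD2l; apply: (le_trans (le_ln1Dx _)).
    by apply: lt_le_trans q0; rewrite oppr_lt0.
  apply: (@le_trans _ _ (tau n.+1 - tau n)); last by rewrite lerBlDl.
  by rewrite ler_pdivrMr // ler_peMr // lerDl.
rewrite /log_weight; lra.
Qed.

Lemma noise_var_ge0 n : 0 <= s n.
Proof.
elim: n => [//|n IH] /=; rewrite addr_ge0 ?sqr_ge0 // mulr_ge0 ?sqr_ge0 //.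
Qed.

Lemma negl2_gamma : negl (2 * rho) gamma.
Proof.
apply: (negl_le (K := 1)) negl_gammaL; near=> n.
by rewrite mul1r normrM ler_peMr // ger0_norm.
Unshelve. all: by end_near. Qed.

Let sqr_1Bg n : (1 - gamma n) ^+ 2 <= expR (- (2 * gamma n)).
Proof.
rewrite -mulrN expRM_natl ler_pXn2r ?nnegrE ?expR_ge0 ?expR_ge1Dx //.
by rewrite subr_ge0; have /andP[_ /ltW] := g01 n.
Qed.

Let two_rho : 0 <= 2 * rho < 2.
Proof. by have /andP[? ?] := rho01; rewrite mulr_ge0 //= gtr_pMr. Qed.

(** The variance contracts at rate 2, so Gronwall requires [2 * rho < 2]; this is where [rho < 1]
    enters. *)
Lemma negl_noise_var : negl (2 * rho) s.
Proof.
apply: (@gronwall _ _ g01 gdec tauoo _ 2 _ gamma two_rho _ _ negl2_gamma).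
  by near=> n; exact: noise_var_ge0.
near=> n; rewrite /= -expr2 lerD2r ler_wpM2r ?noise_var_ge0 //.
Unshelve. all: by end_near. Qed.

(** The product follows the recursion of [s] up to the increments of [log_weight], which are of
    order [gamma n] by [log_weight_step]. *)
Lemma negl_noise_varL : negl (2 * rho) (fun n => s n * log_weight n).
Proof.
apply: (@gronwall _ _ g01 gdec tauoo _ 2 _
  (fun n => (rho + 2) * s n + (gamma n * log_weight n + (rho + 2) * gamma n))
  two_rho).
- by near=> n; rewrite mulr_ge0 ?noise_var_ge0.
- near=> n; have h := log_weight_step n; have s0 := noise_var_ge0 n.
  have /andP[gn0 gn1] := g01 n.
  have sS0 : 0 <= s n.+1 := noise_var_ge0 n.+1.
  apply: (le_trans (ler_wpM2l sS0 h)) => /=.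
  have h1 : (1 - gamma n) ^+ 2 * (s n * log_weight n) <=
      expR (- (2 * gamma n)) * (s n * log_weight n).
    by rewrite ler_wpM2r ?mulr_ge0.
  have r2 : 0 <= rho + 2 by rewrite addr_ge0.
  have h2 : (1 - gamma n) ^+ 2 * (s n * ((rho + 2) * gamma n)) <=
      s n * ((rho + 2) * gamma n).
    apply: ler_piMl; first by rewrite !mulr_ge0 // ltW.
    by apply: exprn_ile1; lra.
  have h3 : gamma n ^+ 2 * ((rho + 2) * gamma n) <= gamma n * ((rho + 2) * gamma n).
    rewrite expr2 -mulrA ler_wpM2l ?(ltW gn0) // ler_piMl ?(ltW gn1) //.
    by rewrite mulr_ge0 // ltW.
  lra.
- have r2 (n : nat) : `|rho + 2| <= rho + 2 by rewrite ger0_norm // addr_ge0.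
  have cM := neglM (K := rho + 2) (c := fun=> rho + 2) r2.
  apply: neglD; first exact: (cM _ _ _ negl_noise_var).
  by apply: neglD => //; exact: (cM _ _ _ negl2_gamma).
Unshelve. all: by end_near. Qed.

(** Comparison with the integral of [(1 + t)^-2]: the term of index [n.+1] is at most
    [1 / (1 + tau n) - 1 / (1 + tau n.+1)], and the first one, where [tau 0 = 0], is below 1. *)
Lemma sum_gamma_weight n :
  \sum_(0 <= i < n.+1) gamma i * (1 + tau i) ^- 2 <= 2 - (1 + tau n)^-1.
Proof.
elim: n => [|n IH].
  have tau0 : tau 0 = 0 by rewrite /Defs.tau big_geq.
  rewrite big_nat1 tau0 addr0 expr1n invr1 mulr1; have /andP[_ ?] := g01 0; lra.
rewrite big_nat_recr //=; apply: (le_trans (lerD IH (lexx _))).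
rewrite -lerBrDl; set a := 1 + tau n.
have a0 : 0 < a by rewrite /a ltr_pwDl.
have bE : 1 + tau n.+1 = a + gamma n.+1 by rewrite tauS addrA.
have b0 : 0 < 1 + tau n.+1 by rewrite ltr_pwDl.
have gn : 0 < gamma n.+1 := g0 n.+1.
set b := 1 + tau n.+1 in bE b0 *.
have -> : 2 - b^-1 - (2 - a^-1) = gamma n.+1 / (a * b).
  have -> : gamma n.+1 = b - a by rewrite bE addrAC subrr add0r.
  by field; rewrite !gt_eqF.
rewrite ler_wpM2l ?(ltW gn) // lef_pV2 ?posrE ?exprn_gt0 ?mulr_gt0 //.
by rewrite expr2 ler_wpM2r ?(ltW b0) // bE lerDl ltW.
Qed.

(** An exponential [Y n] dominates the occupation weight [gamma n * W n] whenever
    [W n * noise >= 1], and its expectations are summable; [occupation_bound] concludes. The free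
    integer [k] later makes the bound small. *)
Lemma noise_upper_bound (g : T -> R) (k : nat) :
  {ae Pr, forall w, \forall n \near \oo,
    k.+1%:R * expR (rho * tau n) * noise g n w <= 2}.
Proof.
pose C := 1 + 2 * \sum_i `|g i|.
have sg0 : 0 <= \sum_i `|g i| by rewrite sumr_ge0.
have C1 : 1 <= C by rewrite /C lerDl mulr_ge0.
have hC n w j : `|g j - \sum_i K n w i * g i| <= C.
  by apply: (le_trans (centered_le K0 K1 g n w j)); rewrite /C lerDr.
pose W n : R := k.+1%:R * expR (rho * tau n).
have W0 n : 0 < W n by rewrite mulr_gt0 ?ltr0n ?expR_gt0.
have Wle : {homo W : m n / (m <= n)%N >-> m <= n}.
  move=> m n mn; rewrite ler_wpM2l // ler_expR ler_wpM2l //.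
  exact: le_tau.
(* From this rank on, the moment bound at [theta n] has exponent at most [log_weight n]; the 8 is
   [2 * 2 ^ 2], the inner 2 being that of [theta n]. *)
have [n0 _ hn0] : \forall n \near \oo,
    8 * C ^+ 2 * (W n ^+ 2 * (s n * log_weight n)) <= 1.
  pose k2 : R := 8 * C ^+ 2 * k.+1%:R ^+ 2.
  have := @cvg0Ml _ k2 _ negl_noise_varL.
  move/cvgr0Pnorm_lt => /(_ 1 ltr01); apply: filterS => n /ltW.
  apply: le_trans; apply: le_trans (ler_norm _).
  have -> : expR (2 * rho * tau n) = expR (rho * tau n) ^+ 2.
    by rewrite -expRM_natl mulrA.
  rewrite /k2 /W exprMn le_eqVlt; apply/orP; left; apply/eqP; ring.
pose theta n := 2 * log_weight n * W n.
pose E n w := expR (theta n * noise g n w).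
(* The exponent [2 * log_weight n] equals [theta n * noise] at the level [W n * noise = 1]; after
   the moment bound a factor [exp (- log_weight n)] is left for summability. *)
pose c n := gamma n * W n * expR (- (2 * log_weight n)).
pose Y n w := if (n0 <= n)%N then c n * E n w else 0.
have c0 n : 0 <= c n by rewrite !mulr_ge0 ?expR_ge0 // ?ltW.
have mE n : measurable_fun setT (E n).
  apply: (adapted_measurable mX (n := n)).
  exact: (adapted_comp (fun t => expR (theta n * t))
           (@adapted_noise _ _ _ _ _ _ _ adK g n)).
have Y0 n w : 0 <= Y n w.
  by rewrite /Y; case: ifP => // _; rewrite mulr_ge0 ?expR_ge0.
have mY n : measurable_fun setT (Y n).
  rewrite /Y; case: (n0 <= n)%N; last exact: measurable_cst.
  by apply: measurable_funM => //; exact: measurable_cst.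
pose B : R := k.+1%:R * 2.
have hB : {ae Pr, forall w, exists M, forall n, \sum_(0 <= i < n) Y i w <= M}.
  apply: (@ae_bounded_sums _ _ _ Pr Y
     (fun n => k.+1%:R * (gamma n * (1 + tau n) ^- 2)) B) => //.
  - move=> n; rewrite /Y; case: leqP => nn0; last first.
      rewrite integral_cst //= mul0e lee_fin !mulr_ge0 // ?invr_ge0 ?exprn_ge0 //.
        exact: ltW.
      by rewrite addr_ge0.
    under eq_integral do rewrite EFinM.
    rewrite ge0_integralZl_EFin //; first last.
    - exact/measurable_EFinP.
    - by move=> w _; rewrite lee_fin expR_ge0.
    have mgf := noise_mgf mX gamma K0 K1 adK condK (theta n) n hC.
    apply: (@le_trans _ _ ((c n)%:E *
        (expR (2 * theta n ^+ 2 * C ^+ 2 * s n))%:E)%E).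
      by apply: lee_wpmul2l; [rewrite lee_fin|exact: mgf].
    rewrite -EFinM lee_fin /c -[leLHS]mulrA -expRD.
    apply: (@le_trans _ _ (gamma n * W n * expR (- log_weight n))).
      rewrite ler_wpM2l ?mulr_ge0 ?(ltW (g0 n)) ?(ltW (W0 n)) // ler_expR.
      have h1 := ler_wpM2r (L0 n) (hn0 n nn0).
      have -> : 2 * theta n ^+ 2 * C ^+ 2 * s n =
        8 * C ^+ 2 * (W n ^+ 2 * (s n * log_weight n)) * log_weight n.
        by rewrite /theta; ring.
      lra.
    have -> : expR (- log_weight n) =
        expR (-1) * expR (- (rho * tau n)) * (1 + tau n) ^- 2.
      rewrite -exprVn -[(1 + tau n)^-1]lnK ?posrE ?invr_gt0 ?ltr_pwDl //.
      rewrite -expRM_natl -!expRD lnV ?posrE ?ltr_pwDl // /log_weight.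
      by congr expR; ring.
    rewrite /W.
    have -> : gamma n * (k.+1%:R * expR (rho * tau n)) *
       (expR (-1) * expR (- (rho * tau n)) * (1 + tau n) ^- 2) =
       expR (-1) * (expR (rho * tau n) * expR (- (rho * tau n))) *
       (k.+1%:R * (gamma n * (1 + tau n) ^- 2)) by ring.
    rewrite -expRD subrr expR0 mulr1 ler_piMl //.
    rewrite !mulr_ge0 // ?(ltW (g0 n)) // invr_ge0 exprn_ge0 //.
    by rewrite addr_ge0.
  - move=> n; rewrite -mulr_sumr ler_wpM2l //.
    case: n => [|n]; first by rewrite big_geq.
    apply: (le_trans (sum_gamma_weight n)); rewrite gerBl invr_ge0.
    by rewrite addr_ge0.
apply: filterS hB => w hw.
have C0 : 0 < 2 * C by rewrite mulr_gt0 // (lt_le_trans ltr01).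
have N_le n : `|noise g n w| <= C.
  elim: n => [|n IH] /=; first by rewrite normr0 (le_trans ler01).
  have /andP[gn0 gn1] := g01 n.
  apply: (le_trans (ler_normD _ _)); rewrite !normrM.
  rewrite (gtr0_norm gn0) ger0_norm ?subr_ge0 ?(ltW gn1) //.
  have h1 := ler_wpM2l (ltW gn0) (hC n w (X n.+1 w)).
  have gn2 : 0 <= 1 - gamma n by rewrite subr_ge0 ltW.
  have h2 := ler_wpM2l gn2 IH.
  by apply: (le_trans (lerD h2 h1)); rewrite -mulrDl subrK mul1r.
apply: (@occupation_bound _ _ g01 gdec tauoo (2 * C) W (fun n => noise g n w)
  (fun n => Y n w) n0) => //.
- move=> n /=; set D := g _ - _.
  have -> : (1 - gamma n) * noise g n w + gamma n * D - noise g n w =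
      gamma n * (D - noise g n w) by ring.
  rewrite normrM (gtr0_norm (g0 n)) [leRHS]mulrC ler_wpM2l ?(ltW (g0 n)) //.
  apply: (le_trans (ler_normB _ _)); rewrite mulrDl mul1r lerD //; exact: hC.
- move=> n nn0 WN1; rewrite /Y nn0 /c /E -[leRHS]mulrA -expRD ler_peMr //.
    by rewrite mulr_ge0 ?(ltW (g0 n)) ?(ltW (W0 n)).
  rewrite -[leLHS]expR0 ler_expR /theta -mulrA.
  have := ler_wpM2l (L0 n) WN1; lra.
Qed.

(** [noise] is odd in [g], so bounds for [g] and [- g] are two-sided; arbitrary [k] turns
    boundedness into convergence to zero. *)
Lemma noise_negl (g : T -> R) :
  {ae Pr, forall w, negl rho (fun n => noise g n w)}.
Proof.
have h1 := ae_foralln (fun k => noise_upper_bound g k).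
have h2 := ae_foralln (fun k => noise_upper_bound (fun j => - g j) k).
apply: filterS2 h1 h2 => w h1 h2.
apply/cvgr0Pnorm_lt => e e0.
pose k := Num.truncn (2 / e).
have ke : 2 / e < k.+1%:R.
  by apply: truncnS_gt; rewrite divr_ge0 // ltW.
near=> n.
have h1n : k.+1%:R * expR (rho * tau n) * noise g n w <= 2.
  by near: n; exact: h1.
have h2n : k.+1%:R * expR (rho * tau n) * noise (fun j => - g j) n w <= 2.
  by near: n; exact: h2.
rewrite noiseN in h2n.
have h3 : k.+1%:R * `|noise g n w * expR (rho * tau n)| <= 2.
  rewrite -[X in X * _](ger0_norm (ler0n R k.+1)) -normrM ler_norml.
  by apply/andP; split; lra.
have kp : 0 < k.+1%:R :> R by rewrite ltr0n.
rewrite -(ltr_pM2l kp); apply: (le_lt_trans h3).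
by rewrite -ltr_pdivrMr.
Unshelve. all: by end_near. Qed.

End noise_decay.

(** * Step sequences, spectrum and the reinforced process *)

Section step_sequence.
Variables (R : realType) (gamma : nat -> R).
Hypothesis hgamma : step_sequence gamma.
Local Notation tau := (tau gamma).
Local Notation negl := (is_negl gamma).

Let g01 : forall n, 0 < gamma n < 1. Proof. by case: hgamma. Qed.

Let g0 n : 0 < gamma n. Proof. by have /andP[] := g01 n. Qed.

Lemma step_tau_cvgy : tau @ \oo --> +oo.
Proof.
have [_ _ gsum _] := hgamma.
have h : (fun n => (\sum_(0 <= i < n) gamma i)%:E) @ \oo --> +oo%E.
  rewrite -gsum; have := @is_cvg_nneseries R (fun n => (gamma n)%:E) xpredT 0%N.
  under [X in _ -> cvgn X]eq_fun do rewrite sumEFin.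
  move=> h; under [X in limn X]eq_fun do rewrite sumEFin.
  by apply: h => n _ _; rewrite lee_fin ltW.
move/cvgeryP/cvgryPge : h => h; apply/cvgryPge => B.
(* The divergent series starts at index 0 and [tau] at index 1, hence the shift by [gamma 0]. *)
have [N _ hN] := h (B + gamma 0%N).
exists N => // n Nn; have := hN n.+1 (leqW Nn) => /=.
by rewrite big_nat_recl // /Defs.tau big_add1 /=; lra.
Qed.

Lemma step_cvg0 : gamma @ \oo --> 0.
Proof.
have [_ _ _ gln] := hgamma.
apply: norm_cvg0.
apply: (@squeeze_cvgr _ _ _ _ (fun=> 0) (fun n => gamma n * ln n%:R)) => //;
  last exact: cvg_cst.
near=> n; rewrite normr_ge0 /= gtr0_norm // ler_peMr ?(ltW (g0 n)) //.
rewrite -[leLHS](@expRK R) ler_ln ?posrE ?expR_gt0 //.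
  by near: n; exact: nbhs_infty_ger.
by near: n; exact: nbhs_infty_gtr.
Unshelve. all: by end_near. Qed.

(** At [rho = 0] the weight is [1 + 2 ln (1 + tau n)], and [tau n <= n] reduces the claim to the
    hypothesis on [gamma n * ln n]. *)
Lemma negl_log_weight0 : negl (2 * 0) (fun n => gamma n * log_weight gamma 0 n).
Proof.
rewrite mulr0; have [_ _ _ gln] := hgamma.
have h : negl 0 (fun n => gamma n * ln n%:R) by exact: cvg0_negl.
have h' : negl 0 gamma by apply: cvg0_negl; exact: step_cvg0.
have h3 : negl 0 (fun n => 3 * gamma n + 2 * (gamma n * ln n%:R)).
  apply: neglD.
    by apply: (neglM (K := 3) (c := fun=> 3)) => // n; rewrite ger0_norm.
  by apply: (neglM (K := 2) (c := fun=> 2)) => // n; rewrite ger0_norm.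
apply: (negl_le (K := 1)) h3; near=> n.
have n1 : 1 <= n%:R :> R by near: n; exact: nbhs_infty_ger.
have n0 : 0 < n%:R :> R by exact: lt_le_trans n1.
have t0 : 0 <= tau n by exact: tau_ge0.
have ln0 : 0 <= ln (n%:R : R) by exact: ln_ge0.
have ln2 : ln (1 + tau n) <= 1 + ln n%:R.
  apply: (@le_trans _ _ (ln (2 * n%:R))).
    rewrite ler_ln ?posrE ?mulr_gt0 ?ltr_pwDl //.
    by rewrite mulr_natl mulr2n lerD // tau_le_nat.
  rewrite lnM ?posrE // lerD2r; have := @le_ln1Dx R 1; rewrite -natr1; apply.
  by lra.
have ln3 : 0 <= ln (1 + tau n) by apply: ln_ge0; rewrite lerDl.
have gn := ltW (g0 n).
rewrite mul1r /log_weight mul0r addr0 !ger0_norm; last 2 first.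
- by rewrite addr_ge0 ?mulr_ge0.
- by rewrite mulr_ge0 // addr_ge0 // mulr_ge0.
have := ler_wpM2l gn ln2; lra.
Unshelve. all: by end_near. Qed.

Lemma limn_esup_lt_near (u : nat -> \bar R) (c : \bar R) :
  (limn_esup u < c)%E -> \forall n \near \oo, (u n < c)%E.
Proof.
rewrite /limn_esup limf_esupE => /ereal_inf_lt[_ [V [N _ hN] <-] h].
exists N => // n Nn; apply: le_lt_trans h; apply: ereal_sup_ubound.
by exists n => //; exact: hN.
Qed.

Lemma limn_esup_le_near (u : nat -> \bar R) (c : \bar R) :
  (\forall n \near \oo, (u n <= c)%E) -> (limn_esup u <= c)%E.
Proof.
move=> h; rewrite /limn_esup limf_esupE.
apply: (@le_trans _ _ (ereal_sup [set u n | n in [set n | (u n <= c)%E]])).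
  by apply: ereal_inf_lbound; exists [set n | (u n <= c)%E].
by apply: ge_ereal_sup => _ [n /= un <-].
Qed.

(** The strict inequality leaves room for some [kap > 2 * rho] with [gamma n <= exp (- kap * tau n)]
    eventually; half of the gap absorbs the weight, at most linear in [tau n]. *)
Lemma negl_log_weight rho : 0 <= rho < 1 -> (ell gamma < (- (2 * rho))%:E)%E ->
  negl (2 * rho) (fun n => gamma n * log_weight gamma rho n).
Proof.
move=> /andP[rho0 rho1] hl.
have [kap [hk kl]] : exists kap, 2 * rho < kap /\ (ell gamma < (- kap)%:E)%E.
  case E : (ell gamma) hl => [l| |] // hl.
    rewrite lte_fin in hl; exists ((2 * rho - l) / 2); rewrite lte_fin.
    by split; lra.
  by exists (2 * rho + 1); split; [lra|exact: ltNyr].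
have /limn_esup_lt_near hg := kl.
pose e := (kap - 2 * rho) / 2.
have e0 : 0 < e by rewrite /e; lra.
have t0 n : 0 <= tau n by exact: tau_ge0.
(* The 3 comes from [rho * tau n + 2 * ln (1 + tau n) <= 3 * tau n]. *)
pose K := 1 + 3 / e.
have K0 : 0 <= K by rewrite /K addr_ge0 // divr_ge0 // ltW.
apply: norm_cvg0.
apply: (@squeeze_cvgr _ _ _ _ (fun=> 0) (fun n => K * expR (- (e * tau n)))).
- near=> n; rewrite normr_ge0 /=.
  have tn : 0 < tau n.
    by near: n; have /cvgryPgt := step_tau_cvgy; exact.
  have gk : gamma n <= expR (- (kap * tau n)).
    have : ((ln (gamma n) / tau n)%:E < (- kap)%:E)%E by near: n.
    rewrite lte_fin ltr_pdivrMr // => h.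
    by rewrite -[leLHS]lnK ?posrE // ler_expR -mulNr ltW.
  have L0 : 0 <= log_weight gamma rho n.
    rewrite /log_weight !addr_ge0 ?mulr_ge0 // ln_ge0 // lerDl //.
  have LK : log_weight gamma rho n <= K * expR (e * tau n).
    have h1 : ln (1 + tau n) <= tau n.
      by apply: le_ln1Dx; rewrite (lt_le_trans _ (t0 n)) // oppr_lt0.
    have h2 : rho * tau n <= tau n by rewrite ler_piMl // ltW.
    have h3 : 1 + e * tau n <= expR (e * tau n) by exact: expR_ge1Dx.
    have h4 : 3 * tau n <= 3 / e * expR (e * tau n).
      have -> : 3 * tau n = 3 / e * (e * tau n) by field; rewrite gt_eqF.
      rewrite ler_wpM2l ?divr_ge0 ?(ltW e0) //; lra.
    have h5 : 0 <= e * tau n by rewrite mulr_ge0 // ltW.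
    rewrite /log_weight /K mulrDl mul1r; lra.
  rewrite !normrM (gtr0_norm (g0 n)) (ger0_norm L0) (ger0_norm (expR_ge0 _)).
  apply: (@le_trans _ _ (expR (- (kap * tau n)) * (K * expR (e * tau n)) *
      expR (2 * rho * tau n))).
    by rewrite ler_wpM2r ?expR_ge0 // ler_pM // ltW.
  rewrite mulrCA -!mulrA -!expRD ler_wpM2l // ler_expR /e; lra.
- exact: cvg_cst.
- by apply/cvg0Ml/expR_tau_cvg0 => //; exact: step_tau_cvgy.
Unshelve. all: by end_near. Qed.

End step_sequence.

(** * Location of the eigenvalues *)

Section spectrum.
Local Notation normc := ComplexField.Normc.normc.
Variables (R : realType) (lam : R).
Hypothesis lam01 : 0 < lam < 1.

(** For [z = a + i b] the real part is [(1 - a) / D], and [D - (1 - lam) (1 - a) = (1 - a) (lam - a)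
    + b^2] vanishes on the disc of radius [lam] only at [z = lam]. *)
Lemma inv1B_Re (z : R[i]) : normc z <= lam ->
  [/\ 1 - z != 0, 0 <= complex.Re (1 / (1 - z)) &
   z = real_complex R lam \/ (1 - lam) * complex.Re (1 / (1 - z)) < 1].
Proof.
have /andP[l0 l1] := lam01; case: z => a b zl.
have ab : a ^+ 2 + b ^+ 2 <= lam ^+ 2.
  rewrite -[leLHS]sqr_sqrtr ?addr_ge0 ?sqr_ge0 //.
  by rewrite ler_pXn2r ?nnegrE ?sqrtr_ge0 // ltW.
have b2 : 0 <= b ^+ 2 by exact: sqr_ge0.
have al : a <= lam.
  rewrite leNgt; apply/negP => h.
  have : lam ^+ 2 < a ^+ 2 by rewrite ltr_pXn2r ?nnegrE // ltW // (lt_trans l0).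
  lra.
have a1 : 0 < 1 - a by lra.
pose D := (1 - a) ^+ 2 + b ^+ 2.
have D0 : 0 < D by rewrite ltr_pwDl // exprn_gt0.
have ReE : complex.Re (1 / (1 - (a +i* b)%C)) = (1 - a) / D.
  by rewrite div1r /= !(sub0r, add0r, oppr0) sqrrN /D.
split.
- rewrite subr_eq0 eq_complex /= negb_and; apply/orP; left.
  by rewrite gt_eqF // -subr_gt0.
- by rewrite ReE divr_ge0 // ltW.
rewrite ReE mulrA ltr_pdivrMr // mul1r.
have DE : D - (1 - lam) * (1 - a) = (1 - a) * (lam - a) + b ^+ 2.
  by rewrite /D; ring.
have [bz|bz] := eqVneq b 0; last first.
  right; rewrite -subr_gt0 DE ltr_wpDl ?mulr_ge0 ?subr_ge0 ?(ltW a1) //.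
    by rewrite -subr_ge0 ltW.
  by rewrite lt_def b2 andbT expf_eq0.
have [->|al'] := eqVneq a lam; first by left; rewrite bz.
right; rewrite -subr_gt0 DE bz expr0n addr0 mulr_gt0 // subr_gt0.
by rewrite lt_neqAle al' al.
Qed.

Lemma max_over_ge (x0 : R[i]) (s : seq R[i]) (f : R[i] -> R) z :
  z \in s -> f z <= max_over x0 s f.
Proof.
by move=> zs; rewrite /max_over; exact: le_bigmax_seq.
Qed.

Lemma max_over_ge_head (x0 : R[i]) (s : seq R[i]) (f : R[i] -> R) :
  f (head x0 s) <= max_over x0 s f.
Proof. exact: bigmax_ge_id. Qed.

Lemma spectrum_le (T : finType) (A : T -> T -> R) (s : seq R[i]) :
  is_spectrum A (real_complex R lam :: s) ->
  forall z, z \in real_complex R lam :: s -> normc z <= lam.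
Proof.
have /andP[l0 l1] := lam01.
case=> _ /= /(order_path_min _) h z; rewrite inE => /predU1P[->|zs].
  by rewrite normc_real gtr0_norm.
have /allP/(_ z zs) : all (fun w => `|w| <= `|real_complex R lam|) s.
  by apply: h => y x t xy yt; exact: le_trans xy.
rewrite !normc_def lecE => /andP[_] /= zle.
by rewrite -[leRHS](gtr0_norm l0) -normc_real; case: z zs zle.
Qed.

End spectrum.

(** * Powers of kernels and irreducibility *)

Section kernels.
Variables (R : realType).

Lemma kpow0 (T : finType) (A : T -> T -> R) i j : kpow A 0 i j = (i == j)%:R.
Proof. by rewrite /kpow expr0 mxE (inj_eq enum_rank_inj). Qed.

Lemma sum_enum_val (T : finType) (f : T -> R) :
  \sum_(k < #|T|) f (enum_val k) = \sum_i f i.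
Proof. by rewrite -(big_enum_val (A := T)). Qed.

Lemma sum_enum_rank (T : finType) (f : 'I_#|T| -> R) :
  \sum_(k < #|T|) f k = \sum_i f (enum_rank i).
Proof.
by rewrite -[RHS]sum_enum_val; apply: eq_bigr => k _; rewrite enum_valK.
Qed.

Lemma kpowS (T : finType) (A : T -> T -> R) k i j :
  kpow A k.+1 i j = \sum_l kpow A k i l * A l j.
Proof.
rewrite /kpow exprSr mxE sum_enum_rank; apply: eq_bigr => l _.
by rewrite [mx_of A _ _]mxE !enum_rankK.
Qed.

Variables (F : finType) (o : F) (P : F -> F -> R).
Hypothesis hP : stochastic P.
Hypothesis habs : absorbing o P.
Hypothesis hirr : irreducible_class o P.

Let P0 i j : 0 <= P i j. Proof. by case: hP. Qed.

Lemma kpow_ge0 k i j : 0 <= kpow P k i j.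
Proof.
elim: k j => [|k IH] j; first by rewrite kpow0.
by rewrite kpowS sumr_ge0 // => l _; rewrite mulr_ge0.
Qed.

(** A positive entry of a power of [P] gives a path of positive transitions. As [o] is absorbing, a
    path ending in [Fstar o] never visits [o], so the closed set contains all its states. *)
Lemma irreducible_closed (S : Fstar o -> Prop) :
  (exists i, S i) -> (forall i j, S i -> 0 < hatP P i j -> S j) ->
  forall j, S j.
Proof.
move=> [i Si] Sstep j.
have reach k (l : Fstar o) : 0 < kpow P k (val i) (val l) -> S l.
  elim: k l => [|k IH] l.
    by rewrite kpow0; case: eqP => [/val_inj <-|]; rewrite ?ltxx.
  rewrite kpowS => h.
  have [m hm] : exists m, 0 < kpow P k (val i) m * P m (val l).
    apply: contrapT => /forallNP hn; move: h; rewrite big1 ?ltxx // => m _.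
    apply/eqP; rewrite eq_le mulr_ge0 ?kpow_ge0 // andbT leNgt.
    by apply/negP/hn.
  have Pml : 0 < P m (val l).
    by rewrite lt_def P0 andbT; apply: contraTneq hm => ->; rewrite mulr0 ltxx.
  have mo : m != o by apply: contraTneq Pml => ->; rewrite habs ltxx.
  have Sm : S (Sub m mo).
    apply: IH; rewrite SubK lt_def kpow_ge0 andbT.
    by apply: contraTneq hm => ->; rewrite mul0r ltxx.
  by apply: Sstep Sm _; rewrite /hatP SubK.
apply: contrapT => nSj; have := hirr i j; rewrite eseries0 ?ltxx // => k _ _.
congr EFin; apply/eqP; rewrite eq_le kpow_ge0 andbT leNgt; apply/negP => h.
exact/nSj/(reach k).
Qed.

Lemma sum_Fstar (f : F -> R) : \sum_i f i = f o + \sum_(i : Fstar o) f (val i).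
Proof. by rewrite (bigD1 o) //=; congr (_ + _); exact: (big_sub (predC1 o)). Qed.

Lemma Kernel_ge0 (x : Fstar o -> R) i j : simplex x -> 0 <= Defs.Kernel P x i j.
Proof. by case=> x0 _; rewrite addr_ge0 // mulr_ge0. Qed.

Lemma Kernel_sum1 (x : Fstar o -> R) i :
  simplex x -> \sum_j Defs.Kernel P x i j = 1.
Proof.
case=> _ x1; rewrite big_split /= -mulr_sumr x1 mulr1 addrC.
by rewrite -sum_Fstar; case: hP.
Qed.

End kernels.

(** * Decay rate of the reinforced process *)

Section reinforced_rate.
Variables (R : realType) (F : finType) (o : F) (P : F -> F -> R).
Hypothesis hP : stochastic P.
Hypothesis habs : absorbing o P.
Hypothesis hirr : irreducible_class o P.
Variables (nu : Fstar o -> R) (lambda : R).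
Hypothesis hnu : is_qsd P nu lambda.
Variable eigs : seq R[i].
Hypothesis heigs : is_spectrum (@hatP R F o P) (real_complex R lambda :: eigs).
Variable gamma : nat -> R.
Hypothesis hgamma : step_sequence gamma.
Variables (d : measure_display) (Omega : measurableType d)
  (Pr : probability Omega R).
Variables (X : nat -> Omega -> Fstar o) (x : nat -> Omega -> Fstar o -> R).
Hypothesis hX : reinforced_process P gamma Pr X x.
Local Notation negl := (is_negl gamma).
Local Notation T := (Fstar o).

Lemma adapted_reinforced n : adapted X n (x n).
Proof.
have [_ _ x0 _ xS] := hX; elim: n => [|n IH] w w' h; apply/funext => j.
  exact: (measurable_wrt_adapted (x0 j)).
rewrite !xS (h n.+1) // (IH w w') // => k kn; apply: h; exact: leqW.
Qed.

(** For [rho = 0] the strict inequality of [inv1B_Re] handles each eigenvalue other than [lambda];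
    otherwise the maximum inside [rate] does. *)
Theorem reinforced_rate rho : 0 <= rho < 1 ->
  negl (2 * rho) (fun n => gamma n * log_weight gamma rho n) ->
  (rho = 0 \/ rho < rate lambda eigs) ->
  {ae Pr, forall w, negl rho (fun n => norm1 (fun i => x n w i - nu i))}.
Proof.
move=> rho01 hL hrate.
have [g01 gdec _ _] := hgamma.
have tauoo := step_tau_cvgy hgamma; have gto0 := step_cvg0 hgamma.
have [mX xs _ xcond xS] := hX.
have [[nu0 nu1] lam01 nuM] := hnu.
have [P0 _] := hP.
pose M := mx_of (@hatP R F o P); pose A := invmx (1%:M - M).
pose K n w := Defs.Kernel P (x n w) (X n w).
have K0 n w j : 0 <= K n w j by exact: Kernel_ge0.
have K1 n w : \sum_j K n w j = 1 by exact: Kernel_sum1.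
have adK n : adapted X n (K n).
  by move=> w w' h; rewrite /K (adapted_reinforced h) (h n).
(* Column [j] of [A], so that [noise] of [g j] is the coordinate [j] of the noise row. *)
pose g j (i : T) : R := A (enum_rank i) j.
have hnoise : {ae Pr, forall w, forall j : 'I_#|T|,
    negl rho (fun n => noise X gamma K (g j) n w)}.
  apply: filter_forall => j.
  exact: (noise_negl mX g01 gdec tauoo K0 K1 adK xcond rho01 hL).
apply: filterS hnoise => w hN.
pose row (f : T -> R) : 'rV[R]_#|T| := \row_j f (enum_val j).
have rowM (f : T -> R) (B : 'M[R]_#|T|) j :
    (row f *m B) 0 j = \sum_i f i * B (enum_rank i) j.
  rewrite mxE sum_enum_rank; apply: eq_bigr => i _.
  by rewrite mxE enum_rankK.
have sum_row f : \sum_j row f 0 j = \sum_i f i.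
  by rewrite -[RHS]sum_enum_val; apply: eq_bigr => j _; rewrite mxE.
have dirac_row i (B : 'M[R]_#|T|) j :
    (row (dirac_mass R i) *m B) 0 j = B (enum_rank i) j.
  rewrite rowM (bigD1 i) //= /dirac_mass eqxx mul1r big1 ?addr0 // => l li.
  by rewrite (negbTE li) mul0r.
have irr (S : 'I_#|T| -> Prop) : (exists i, S i) ->
    (forall i j, S i -> 0 < M i j -> S j) -> forall j, S j.
  move=> [i Si] Sstep j; rewrite -(enum_valK j).
  apply: (irreducible_closed hP habs hirr (S := fun i => S (enum_rank i))).
    by exists (enum_val i); rewrite enum_valK.
  by move=> k l Sk hkl; apply: Sstep Sk _; rewrite mxE !enum_rankK.
have hrow j : negl rho (fun n => row (x n w) 0 j - row nu 0 j).
  move: j; apply: (@pathwise_rate _ _ g01 gdec tauoo gto0 _ M lambda (row nu) _ irr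
    lam01 _ _ _ _ (proj1 heigs) (fun n => row (x n w))
    (fun n => row (dirac_mass R (X n w)))
    (fun n => \row_j noise X gamma K (g j) n w) (fun n => P (val (X n w)) o)).
  - by move=> i j; rewrite mxE; exact: P0.
  - by move=> i; rewrite mxE.
  - by rewrite sum_row.
  - apply/rowP => j; rewrite rowM [RHS]mxE [row nu 0 j]mxE -nuM.
    by apply: eq_bigr => i _; rewrite mxE enum_rankK.
  - move=> k; rewrite P0 /=; have [_ P1] := hP.
    rewrite -(P1 (val (X k w))) (bigD1 o) //= lerDl.
    by apply: sumr_ge0.
  - by move=> k j; rewrite mxE; have [] := xs k w.
  - by move=> k; rewrite sum_row; have [] := xs k w.
  - move=> k j; rewrite mxE /dirac_mass; case: (_ == _); by rewrite ?ler01 ?lexx.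
  - by move=> k; apply/rowP => j; rewrite !mxE xS.
  - move=> k; apply/rowP => j.
    (* Stated for abstract rows, so that taking entries does not unfold the matrix products. *)
    have E (u1 u2 u3 u4 : 'rV[R]_#|T|) (a b c : R) :
        (a *: u1 + b *: (u2 - u3 - c *: u4)) 0 j =
        a * u1 0 j + b * (u2 0 j - u3 0 j - c * u4 0 j) by rewrite !mxE.
    have NE n : (\row_j noise X gamma K (g j) n w) 0 j = noise X gamma K (g j) n w.
      by rewrite mxE.
    (* What remains is the mean of [g j] under the kernel: an entry of [M A] plus [P (X k) o] times
       an entry of [x A]. *)
    rewrite E !dirac_row rowM !NE /=; congr (_ + _ * _).
    rewrite -addrA -opprD; congr (_ - _).
    have -> : (M *m A) (enum_rank (X k w)) j =
        \sum_i hatP P (X k w) i * A (enum_rank i) j.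
      rewrite mxE sum_enum_rank; apply: eq_bigr => i _.
      by rewrite mxE !enum_rankK.
    rewrite mulr_sumr -big_split /=; apply: eq_bigr => i _.
    by rewrite /K /Defs.Kernel /hatP /g mulrDl mulrA.
  - exact: rho01.
  - have /andP[rho0 _] := rho01.
    apply: (negl_leq_rate g01 _ (negl2_gamma g01 rho01 hL)).
    by rewrite mulr_natl mulr2n lerDl.
  - move=> z zs; have [z1 Re0 zlt] := inv1B_Re lam01 (spectrum_le lam01 heigs zs).
    move: zs; rewrite inE => /predU1P[->|zs]; first by left.
    case: hrate zlt => [->|hr] [->|zlt]; [by left| |by left|].
      by right; rewrite subr_gt0.
    right; split => //; apply: lt_le_trans hr _.
    rewrite /rate lerD2l lerN2 ler_wpM2l //.
      by rewrite subr_ge0; case/andP: lam01 => _ /ltW.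
    exact: (max_over_ge 0 (fun z => complex.Re (1 / (1 - z))) zs).
  - by move=> j; have := hN j; congr is_negl; apply/funext => n; rewrite mxE.
apply: negl_sum => i; apply: norm_negl.
have := hrow (enum_rank i); congr is_negl.
by apply/funext => n; rewrite !mxE enum_rankK.
Qed.

End reinforced_rate.

(** * From negligibility to the logarithmic rate *)

Lemma lne_norm_le (R : realType) (t rho r : R) : 0 < t ->
  r <= expR (- (rho * t)) ->
  ((t^-1)%:E * lne r%:E <= (- rho)%:E)%E.
Proof.
move=> t0 hr; have [r0|r0] := ltP 0 r.
  rewrite lne_EFin // -EFinM lee_fin mulrC ler_pdivrMr // mulNr.
  by rewrite -[leRHS](@expRK R) ler_ln ?posrE ?expR_gt0.
(* Here [lne] is [-oo], which covers the times when [x] equals [nu]. *)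
by rewrite le0_lneNy ?lee_fin // gt0_muleNy ?leNye // lte_fin invr_gt0.
Qed.

Lemma negl_limn_esup (R : realType) (gamma v : nat -> R) (rho : R) :
  (tau gamma @ \oo --> +oo) -> is_negl gamma rho v ->
  (limn_esup (fun n => ((tau gamma n)^-1)%:E * lne (v n)%:E) <= (- rho)%:E)%E.
Proof.
move=> tauoo; rewrite /is_negl => /cvgr0Pnorm_lt/(_ 1 ltr01) hv.
apply: limn_esup_le_near; near=> n; apply: lne_norm_le.
  by near: n; have /cvgryPgt := tauoo; exact.
rewrite expRN -div1r ler_pdivlMr ?expR_gt0 //; apply: le_trans (ler_norm _) _.
by apply: ltW; near: n.
Unshelve. all: by end_near. Qed.

Theorem theorem1p2 (R : realType) (F : finType) (o : F) (P : F -> F -> R)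
  (hd : (2 <= #|Fstar o|)%N)
  (hP : stochastic P)
  (habs : absorbing o P)
  (hexit : exists i : Fstar o, 0 < P (val i) o)
  (hirr : irreducible_class o P)
  (nu : Fstar o -> R) (lambda : R)
  (hnu : is_qsd P nu lambda)
  (eigs : seq R[i])
  (heigs : is_spectrum (@hatP R F o P) (real_complex R lambda :: eigs))
  (gamma : nat -> R)
  (hgamma : step_sequence gamma)
  (d : measure_display) (Omega : measurableType d) (Pr : probability Omega R)
  (X : nat -> Omega -> Fstar o) (x : nat -> Omega -> Fstar o -> R)
  (hX : reinforced_process P gamma Pr X x) :
  {ae Pr, forall w,
     norm1 (fun i => x n w i - nu i) @[n --> \oo] --> (0 : R)} /\
  ((ell gamma < 0)%E ->
   {ae Pr, forall w,
     (limn_esup (fun n => ((tau gamma n)^-1)%:E *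
                          lne (norm1 (fun i => x n w i - nu i))%:E)
      <= maxe (- (rate lambda eigs)%:E) (ell gamma * (2^-1)%:E))%E}).
Proof.
have [g01 _ _ _] := hgamma; have tauoo := step_tau_cvgy hgamma.
have ae0 : {ae Pr, forall w,
    is_negl gamma 0 (fun n => norm1 (fun i => x n w i - nu i))}.
  apply: (reinforced_rate hP habs hirr hnu heigs hgamma hX).
  - by rewrite lexx ltr01.
  - exact: negl_log_weight0.
  - by left.
split.
  by apply: filterS ae0 => w; exact: negl_cvg0.
move=> ell0.
have rate1 : rate lambda eigs <= 1.
  have [_ lam01 _] := hnu; have /andP[l0 l1] := lam01.
  rewrite /rate gerBl mulr_ge0 ?subr_ge0 ?(ltW l1) //.
  apply: le_trans (max_over_ge_head _ _ _).
  (* The value at the head is nonnegative; for an empty list the default [0] gives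
     [1 / (1 - 0) = 1]. *)
  case: eigs heigs => [|z s] hs; rewrite [head _ _]/=.
    by rewrite subr0 divr1; exact: ler01.
  by have [] := inv1B_Re lam01 (spectrum_le lam01 hs (z := z) _);
    rewrite // !inE eqxx orbT.
pose m := (maxe (- (rate lambda eigs)%:E) (ell gamma * (2^-1)%:E))%E.
have m_rate : (- (rate lambda eigs)%:E <= m)%E by rewrite le_max lexx.
have m_ell : (ell gamma * (2^-1)%:E <= m)%E by rewrite le_max lexx orbT.
(* [m] is at least the real number [- rate] and below [+oo], hence finite even when
   [ell gamma = -oo]. *)
have mfin : m \is a fin_num.
  rewrite fin_numElt (lt_le_trans _ m_rate) ?ltNyr //= gt_max ltry /=.
  case: (ell gamma) ell0 => [l _| |_] //; first by rewrite -EFinM ltry.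
  by rewrite gt0_mulNye ?lte_fin.
have mE : m = (fine m)%:E by rewrite fineK.
have m_ratef : - fine m <= rate lambda eigs.
  by move: m_rate; rewrite mE lee_fin; lra.
(* Rates just below [- m], truncated at 0, where convergence alone is used. *)
pose rho (k : nat) : R := Num.max 0 (- fine m - k.+1%:R^-1).
have aek k : {ae Pr, forall w,
    is_negl gamma (rho k) (fun n => norm1 (fun i => x n w i - nu i))}.
  have k0 : 0 < k.+1%:R^-1 :> R by rewrite invr_gt0.
  have [rk|rk] := leP (- fine m - k.+1%:R^-1) 0.
    by rewrite /rho max_l.
  rewrite /rho max_r ?ltW //; set r := - fine m - _ in rk *.
  have rm : r < - fine m by rewrite /r gtrBl.
  have r01 : 0 <= r < 1.
    by rewrite ltW //= (lt_le_trans rm) // (le_trans m_ratef).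
  apply: (reinforced_rate hP habs hirr hnu heigs hgamma hX) => //.
    (* [ell gamma / 2 <= m < - r] provides the strict inequality on [ell gamma]. *)
    apply: negl_log_weight => //.
    move: m_ell; rewrite mE; case: (ell gamma) ell0 => [l _| |_] //.
      rewrite -EFinM lee_fin lte_fin => h; lra.
    by move=> _; rewrite ltNyr.
  by right; exact: lt_le_trans rm m_ratef.
(* The countably many rates [rho k] hold on one almost sure event, and [k] large brings the bound
   within [e] of [m]. *)
have := ae_foralln aek; apply: filterS => w hw.
rewrite -/m mE; apply/lee_addgt0Pr => e e0.
pose k := Num.truncn e^-1.
have ke : k.+1%:R^-1 < e.
  rewrite -[ltRHS]invrK ltf_pV2 ?posrE ?invr_gt0 //.
  by apply: truncnS_gt; rewrite invr_ge0 ltW.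
apply: (le_trans (negl_limn_esup tauoo (hw k))).
rewrite -EFinD lee_fin.
have : - fine m - k.+1%:R^-1 <= rho k by rewrite le_max lexx orbT.
set q := k.+1%:R^-1 in ke *; set r := rho k; lra.
Qed.
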